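(* For every integer $n\ge0$, with the notation of the context, the matrix $\mathrm{ch}^{(n)}_\Gamma$ satisfies $$\left(\tfrac{1}{(2\pi)^{n/2}}\mathrm{ch}^{(n)}_\Gamma\right)^{-1}\mathbf{e}\!\left[\widetilde Q^{(n)}\right]\left(\tfrac{1}{(2\pi)^{n/2}}\mathrm{ch}^{(n)}_\Gamma\right)=\mathbf{S}^{(n)},$$ $$\left(\tfrac{1}{(2\pi)^{n/2}}\mathrm{ch}^{(n)}_\Gamma\right)^{T}\mathbf{e}\!\left[\tfrac12\widetilde Q^{(n)}\right]\eta^{(n)}\left(\tfrac{1}{(2\pi)^{n/2}}\mathrm{ch}^{(n)}_\Gamma\right)=\chi^{(n)},$$ where $\mathbf{S}^{(n)}:=(\chi^{(n)})^{-1}(\chi^{(n)})^T$.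
   Context: Fix integers $a_1,a_2,\ldots\ge2$; $d_0=1$, $d_i=a_1\cdots a_i$; $\widetilde\mu_n=\sum_{i=0}^n(-1)^{n-i}d_i$; $\mathbf{e}[\alpha]=\exp(2\pi\sqrt{-1}\alpha)$, applied entrywise to diagonal matrices. Index sets: $I_0=\{1\}$; $I'_n=\{\kappa\in\{1,\dots,d_n\}\mid a_n\nmid\kappa\}$ ($n\ge1$); $I_1=I'_1$; $I_n=I'_n\sqcup I_{n-2}$ (formal disjoint union, $|I_n|=\widetilde\mu_n$) for $n\ge2$; matrices indexed by $I_n$ are written in block form with respect to $I'_n$ then $I_{n-2}$ (recursively). For $\kappa\in I'_n$, $\omega^{(n)}_{\kappa,i}:=(-1)^{i-1}\frac{d_{i-1}}{d_n}\kappa-\lfloor(-1)^{i-1}\frac{d_{i-1}}{d_n}\kappa\rfloor$. $\eta^{(n)}$ ($I_n\times I_n$): $\eta^{(0)}=(1)$, $\eta^{(1)}=(\frac{1}{a_1}\delta_{\kappa+\lambda,a_1})$, and for $n\ge2$, $\eta^{(n)}=\mathrm{diag}\big((\frac{1}{d_n}\delta_{\kappa+\lambda,d_n})_{\kappa,\lambda\in I'_n},\,-\frac{1}{a_n}\eta^{(n-2)}\big)$. $\widetilde Q^{(n)}$ (diagonal, $I_n\times I_n$): $\widetilde Q^{(0)}=(0)$; $\widetilde Q^{(1)}=\mathrm{diag}(\omega^{(1)}_{\kappa,1}-\frac12)_{\kappa\in I_1}$; for $n\ge2$, $\widetilde Q^{(n)}=\mathrm{diag}\big(\mathrm{diag}(\sum_{l=1}^n(\omega^{(n)}_{\kappa,l}-\frac12))_{\kappa\in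 I'_n},\,\widetilde Q^{(n-2)}\big)$. For $\kappa\in I'_n$: if $n=2m-1$, $c^{(n)}_\kappa=\prod_{l=1}^n\Gamma(1-\omega^{(n)}_{\kappa,l})\prod_{i=1}^m(1-\mathbf{e}[\omega^{(n)}_{\kappa,2i-1}])$; if $n=2m$, $c^{(n)}_\kappa=\prod_{l=1}^n\Gamma(1-\omega^{(n)}_{\kappa,l})\prod_{i=1}^m(1-\mathbf{e}[\omega^{(n)}_{\kappa,2i}])$. For $j\in\mathbb{Z}$, vectors $\mathrm{ch}^{(n)}_{\Gamma,j}\in\mathbb{C}^{I_n}$: $\mathrm{ch}^{(0)}_{\Gamma,j}=(1)$; $(\mathrm{ch}^{(1)}_{\Gamma,j})_\kappa=c^{(1)}_\kappa\mathbf{e}[\omega^{(1)}_{\kappa,1}(j-1)]$; for $n\ge2$, $(\mathrm{ch}^{(n)}_{\Gamma,j})_\kappa=c^{(n)}_\kappa\mathbf{e}[(-1)^{n-1}\omega^{(n)}_{\kappa,1}(j-1)]$ if $\kappa\in I'_n$ and $=2\pi\sqrt{-1}\,(\mathrm{ch}^{(n-2)}_{\Gamma,j})_\kappa$ if $\kappa\in I_{n-2}$. The $\widetilde\mu_n\times\widetilde\mu_n$ matrix $\mathrm{ch}^{(n)}_\Gamma:=(\mathrm{ch}^{(n)}_{\Gamma,1},\dots,\mathrm{ch}^{(n)}_{\Gamma,\widetilde\mu_n})$ (rows indexed by $I_n$, columns by $j=1,\dots,\widetilde\mu_n$). $\chi^{(n)}$ ($\widetilde\mu_n\times\widetilde\mu_n$):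 $\chi^{(n)}=1/\varphi_n(N)$ where $N=(\delta_{i+1,j})$ is the nilpotent shift matrix, $\varphi_n(t)=\prod_{i=0}^n(1-t^{d_i})^{(-1)^{n-i}}$ for $n\ge1$, $\varphi_0(t)=1-t$ (i.e. expand $1/\varphi_n(t)$ as a power series in $t$ and substitute $N$). $\chi^{(n)}$ is the Euler form matrix of a full exceptional collection in the category of $L_{f_n}$-graded matrix factorizations of $f_n=z_1^{a_1}z_2+\cdots+z_n^{a_n}$, and $\mathbf{S}^{(n)}$ is the matrix of the Serre functor on its Grothendieck group. *)

(* Defs.v *)
From HB Require Import structures.
From mathcomp Require Import all_boot all_order all_algebra.
From mathcomp Require Import all_classical all_reals.
From mathcomp Require Import interval_inference topology normedtype sequences
  exp trigo measure lebesgue_measure lebesgue_integral.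
From mathcomp Require Import complex.

Set Implicit Arguments.
Unset Strict Implicit.
Unset Printing Implicit Defensive.

Import Order.TTheory GRing.Theory Num.Theory.
Local Open Scope ring_scope.
Local Open Scope complex_scope.

Section Defs.
Variable R : realType.
Local Notation C := (R[i]).

(** Euler's Gamma function on the reals, Gamma s = int_0^oo t^(s-1) e^(-t) dt
    (used only for s in (0,1]). *)
Definition Gamma (s : R) : R :=
  Rintegral (@lebesgue_measure R) [set t : R | 0 < t]%classic
    (fun t => t `^ (s - 1) * expR (- t)).

Definition ee (x : R) : C := (cos (2 * pi * x)) +i* (sin (2 * pi * x)).

Definition twopii : C := 0 +i* (2 * pi).

Variable a : nat -> nat.

Definition d (i : nat) : nat := (\prod_(1 <= k < i.+1) a k)%N.

Definition Iprime (n : nat) : seq nat :=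
  [seq k <- iota 1 (d n) | ~~ (a n %| k)%N].

Definition cnt (n : nat) : nat := size (Iprime n).

Definition kap (n : nat) (k : nat) : nat := nth 0 (Iprime n) k.

(** |I_n|, where I_0 = {1}, I_1 = I'_1, I_n = I'_n + I_(n-2) *)
Fixpoint mu (n : nat) : nat :=
  match n with
  | 0 => 1
  | 1 => cnt 1
  | m.+2 => (cnt m.+2 + mu m)%N
  end.

Definition omega (n kappa i : nat) : R :=
  let x := (-1) ^+ (i.-1) * (d i.-1)%:R / (d n)%:R * kappa%:R in
  x - (Num.floor x)%:~R.

Definition cc (n kappa : nat) : C :=
  (\prod_(1 <= l < n.+1) (Gamma (1 - omega n kappa l))%:C) *
  (if odd n then
     \prod_(1 <= i < (n.+1)./2 .+1) (1 - ee (omega n kappa (2 * i).-1))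
   else
     \prod_(1 <= i < n./2 .+1) (1 - ee (omega n kappa (2 * i)))).

Definition chtop (n kappa : nat) (j : int) : C :=
  cc n kappa * ee ((-1) ^+ (n.-1) * omega n kappa 1 * (j%:~R - 1)).

Fixpoint chv (n : nat) (j : int) : 'cV[C]_(mu n) :=
  match n return 'cV[C]_(mu n) with
  | 0 => const_mx 1
  | 1 => \col_(k < cnt 1) chtop 1 (kap 1 k) j
  | m.+2 => col_mx (\col_(k < cnt m.+2) chtop m.+2 (kap m.+2 k) j)
                   (twopii *: chv m j)
  end.

Definition chm (n : nat) : 'M[C]_(mu n) :=
  \matrix_(i, j) chv n (j.+1)%:Z i ord0.

(** diagonal entries of Q~^(n) *)
Fixpoint Qv (n : nat) : 'cV[R]_(mu n) :=
  match n return 'cV[R]_(mu n) with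
  | 0 => const_mx 0
  | 1 => \col_(k < cnt 1) (omega 1 (kap 1 k) 1 - 2^-1)
  | m.+2 => col_mx
      (\col_(k < cnt m.+2) \sum_(1 <= l < m.+3) (omega m.+2 (kap m.+2 k) l - 2^-1))
      (Qv m)
  end.

Definition eQ (t : R) (n : nat) : 'M[C]_(mu n) :=
  diag_mx (\row_i ee (t * Qv n i ord0)).

Fixpoint etam (n : nat) : 'M[C]_(mu n) :=
  match n return 'M[C]_(mu n) with
  | 0 => 1%:M
  | 1 => \matrix_(k < cnt 1, l < cnt 1)
           ((a 1)%:R^-1 * (kap 1 k + kap 1 l == a 1)%:R)
  | m.+2 => block_mx
      (\matrix_(k < cnt m.+2, l < cnt m.+2)
         ((d m.+2)%:R^-1 * (kap m.+2 k + kap m.+2 l == d m.+2)%:R))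
      0 0 (- (a m.+2)%:R^-1 *: etam m)
  end.

Definition shiftN (m : nat) : 'M[C]_m := \matrix_(i, j) (i.+1 == j :> nat)%:R.
Definition mxpow (m : nat) (A : 'M[C]_m) (k : nat) : 'M[C]_m := iter k (mulmx A) 1%:M.

(** chim^(n) = 1/phi_n(N), with
    1/phi_n(t) = prod_(i=0..n) (1 - t^(d_i))^(-(-1)^(n-i)) *)
Definition chim (n : nat) : 'M[C]_(mu n) :=
  \big[mulmx/1%:M]_(i < n.+1)
    (if odd (n - i) then 1%:M - mxpow (shiftN (mu n)) (d i)
     else invmx (1%:M - mxpow (shiftN (mu n)) (d i))).

Definition Serre (n : nat) : 'M[C]_(mu n) := invmx (chim n) *m (chim n)^T.

Definition chnorm (n : nat) : 'M[C]_(mu n) :=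
  (((2 * pi) `^ (n%:R / 2))^-1)%:C *: chm n.

End Defs.

(* Main.v *)
(** Write u = e[(-1)^(n-1) kappa/d_n].  By the reflection formula for Gamma, the
    product of the kappa-th and (d_n - kappa)-th entries of ch_Gamma, twisted by
    e[Q/2], is phi_(n-1)(u) u^(j-k), where phi_(n-1) is a polynomial of degree
    d_n - mu_n.  The kappa divisible by a_n, which are missing from I'_n, are
    exactly accounted for by the block of level n-2, because phi_(n-1) vanishes
    on the d_(n-1)-th roots of unity except those of order dividing d_(n-2),
    where it equals a_(n-1) phi_(n-3).  Hence the second identity is a discrete
    Fourier inversion extracting the coefficient of t^(k-j) in phi_(n-1), which
    is the (j,k) entry of 1/phi_n(N) = phi_(n-1)(N) / (1 - N^(d_n)) as
    N^(d_n) = 0.  The first identity follows from the second, since eta is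
    symmetric and e[Q/2] eta e[Q/2] = eta.

    For the reflection formula, Tonelli gives Gamma(s) Gamma(1-s) =
    B(s) + B(1-s), where B(s) is the integral of u^(s-1)/(1+u) over (0,1), and
    Herglotz's trick identifies the right-hand side with pi/sin(pi s): both sides
    satisfy 3 h(s) = h(s/3) - h((s+1)/3) + h((s+2)/3), and their difference
    vanishes at the end points of (0,1). *)
Require Import Defs.
From HB Require Import structures.
From mathcomp Require Import all_boot all_order all_algebra.
From mathcomp Require Import all_classical all_reals.
From mathcomp Require Import interval_inference topology ereal normedtype derive
  realfun sequences exp trigo measure measurable_realfun lebesgue_measure numfun
  lebesgue_integral ftc.
From mathcomp Require Import complex.
From mathcomp Require Import zify ring lra.

Set Implicit Arguments.
Unset Strict Implicit.
Unset Printing Implicit Defensive.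

Import Order.TTheory GRing.Theory Num.Theory.
Import numFieldNormedType.Exports.
Local Open Scope ring_scope.

(** * The reflection formula for Gamma *)

Section Herglotz.
Variable R : realType.
Implicit Types (B h : R -> R) (s x : R).

(* These properties characterise [B s = int_0^1 u^(s-1)/(1+u) du =
   sum_k (-1)^k / (s+k)] on [s > 0]. *)
Definition alternating_beta B :=
  [/\ forall s, 0 < s -> 0 <= B s,
      forall s t, 0 < s -> s <= t -> B t <= B s &
      forall s, 0 < s -> B s + B (s + 1) = s^-1].

(** Antiperiodicity carries the value at s unchanged in absolute value to s + k, where the bound K /
    (s + k) tends to 0. *)
Lemma antiperiodic_small0 (D : R -> R) (K : R) :
  (forall s, 0 < s -> D (s + 1) = - D s) ->
  (forall s, 0 < s -> `|D s| <= K / s) ->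
  forall s, 0 < s -> D s = 0.
Proof.
move=> D1 DK s s0.
have Dk k : `|D s| = `|D (s + k%:R)|.
  elim: k => [|k ->]; first by rewrite addr0.
  by rewrite -natr1 addrA D1 ?normrN// ltr_wpDr.
have DKk k : `|D s| * k.+1%:R <= K.
  rewrite (Dk k.+1) (le_trans (ler_wpM2r _ (DK _ _)))// ?ltr_wpDr//.
  rewrite mulrAC ler_pdivrMr ?ltr_wpDr// ler_wpM2l//.
    have := DK 1 ltr01; rewrite divr1; exact: le_trans.
  by rewrite lerDr ltW.
apply/eqP; rewrite -normr_eq0; apply/eqP/le_anti; rewrite normr_ge0 andbT.
rewrite leNgt; apply/negP => Ds0.
have := DKk (Num.bound (K / `|D s|)); rewrite leNgt => /negP; apply.
rewrite mulrC -ltr_pdivrMr//.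
apply: (@lt_trans _ _ (Num.bound (K / `|D s|))%:R); last by rewrite ltr_nat.
apply: archi_boundP; rewrite divr_ge0//.
have := DK 1 ltr01; rewrite divr1; exact: le_trans.
Qed.

Lemma alternating_beta_le B s : alternating_beta B -> 0 < s -> B s <= s^-1.
Proof.
move=> [B0 _ BE] s0; rewrite -BE// lerDl B0//.
by rewrite ltr_wpDr.
Qed.

Lemma alternating_beta_unique B B' :
  alternating_beta B -> alternating_beta B' -> forall s, 0 < s -> B s = B' s.
Proof.
move=> hB hB' s s0; apply/eqP; rewrite -subr_eq0; apply/eqP.
apply: (@antiperiodic_small0 (fun s => B s - B' s) 1) => // {s s0} s s0.
  case: hB hB' => [_ _ BE] [_ _ /(_ _ s0) BE'].
  by have := BE _ s0; move: BE'; lra.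
have := alternating_beta_le hB s0; have := alternating_beta_le hB' s0.
case: hB hB' => [/(_ _ s0) B0 _ _] [/(_ _ s0) B'0 _ _].
by rewrite div1r ler_norml => *; apply/andP; split; lra.
Qed.

(** The difference of the two sides is antiperiodic: s -> s + 1 moves the three arguments up
    cyclically, and for the one that wraps to s/3 + 1 the functional equation at s/3 produces 3/s,
    which cancels the term coming from 3 B(s + 1). *)
Lemma alternating_beta_triple B s : alternating_beta B -> 0 < s ->
  3 * B s = B (s / 3) - B ((s + 1) / 3) + B ((s + 2) / 3).
Proof.
move=> hB s0; apply/eqP; rewrite -subr_eq0; apply/eqP.
apply: (@antiperiodic_small0 (fun s => 3 * B s -
  (B (s / 3) - B ((s + 1) / 3) + B ((s + 2) / 3))) 12) => // {s s0} s s0.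
  have [_ _ BE] := hB.
  have -> : (s + 1 + 1) / 3 = (s + 2) / 3 :> R by lra.
  have -> : (s + 1 + 2) / 3 = s / 3 + 1 :> R by lra.
  have := BE _ s0; have s3 : 0 < s / 3 by lra.
  have := BE _ s3; rewrite invf_div; lra.
(* All four arguments are at least s/3. The extreme value 3 B(s) + B((s+1)/3) is at most 4 (3/s),
   hence the constant 12. *)
have le t : s / 3 <= t -> 0 <= B t <= 3 / s.
  move=> st; have t0 : 0 < t by lra.
  have [-> // _ _] := hB; apply: (le_trans (alternating_beta_le hB t0)).
  by rewrite -[leRHS]invf_div lef_pV2// posrE; lra.
have /andP[a1 a2] : 0 <= B s <= 3 / s by apply: le; lra.
have /andP[b1 b2] : 0 <= B (s / 3) <= 3 / s by apply: le; lra.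
have /andP[c1 c2] : 0 <= B ((s + 1) / 3) <= 3 / s by apply: le; lra.
have /andP[d1 d2] : 0 <= B ((s + 2) / 3) <= 3 / s by apply: le; lra.
have -> : 12 / s = 4 * (3 / s) by rewrite mulrA -natrM.
by rewrite ler_norml; apply/andP; split; lra.
Qed.

Lemma cos_pithird : cos (pi / 3) = 2^-1 :> R.
Proof.
have e : cos (pi / 3 + pi / 3 *+ 2) = -1 :> R.
  by rewrite (_ : pi / 3 + _ = pi) ?cospi//; lra.
have := e; rewrite cosD cos_mulr2n sin_mulr2n.
have := @sin2cos2 R (pi / 3).
set c := cos (pi / 3); set t := sin (pi / 3) => et ec.
have c0 : 0 < c.
  apply: cos_gt0_pihalf; have := @pi_gt0 R => ?; apply/andP; split; lra.
(* The triple-angle formula at pi/3 reads 4 c^3 - 3 c + 1 = 0, and this is its factorisation; c > 0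
   then leaves 1/2. *)
have : (c + 1) * (2 * c - 1) ^+ 2 = 0.
  have -> : (c + 1) * (2 * c - 1) ^+ 2 =
    (c * (c ^+ 2 *+ 2 - 1) - t * (c * t *+ 2)) + 1 + 2 * c * (t ^+ 2 - (1 - c ^+ 2)).
    by ring.
  by rewrite ec et subrr mulr0 addr0 addNr.
move/eqP; rewrite mulf_eq0 sqrf_eq0 => /orP[/eqP|/eqP]; lra.
Qed.

(** The counterpart for the cosecant of [alternating_beta_triple]. It rests on sin(3x) = 4 sin(x)
    sin(x + pi/3) sin(x + 2 pi/3), which serves as common denominator. *)
Lemma inv_sin_triple x : sin (3 * x) != 0 ->
  3 / sin (3 * x) = (sin x)^-1 - (sin (x + pi / 3))^-1 + (sin (x + 2 * (pi / 3)))^-1.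
Proof.
have st : sin (pi / 3 : R) ^+ 2 = 3 / 4.
  by rewrite sin2cos2 cos_pithird; lra.
have -> : 3 * x = x + x *+ 2 by ring.
have -> : 2 * (pi / 3) = pi / 3 *+ 2 :> R by ring.
rewrite (sinD x (x *+ 2)) (sinD x (pi / 3)) (sinD x (pi / 3 *+ 2)).
rewrite !cos_mulr2n !sin_mulr2n cos_pithird.
set t := sin (pi / 3) in st *; set S := sin x; set K := cos x.
have KS : K ^+ 2 = 1 - S ^+ 2 by exact: cos2sin2.
have -> : S * (K ^+ 2 *+ 2 - 1) + K * ((K * S) *+ 2) = S * (3 - 4 * S ^+ 2).
  have -> : S * (K ^+ 2 *+ 2 - 1) + K * (K * S *+ 2) = S * (4 * K ^+ 2 - 1) by ring.
  by rewrite KS; ring.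
have -> : S * (2^-1 ^+ 2 *+ 2 - 1) + K * ((2^-1 * t) *+ 2) = K * t - S / 2 by field.
have pE : (S * 2^-1 + K * t) * (K * t - S / 2) = (3 - 4 * S ^+ 2) / 4.
  have -> : (S * 2^-1 + K * t) * (K * t - S / 2) = K ^+ 2 * t ^+ 2 - S ^+ 2 / 4 by field.
  by rewrite KS st; field.
rewrite mulf_eq0 negb_or => /andP[S0 q0].
have : (S * 2^-1 + K * t) * (K * t - S / 2) != 0.
  by rewrite pE mulf_neq0// invr_eq0 pnatr_eq0.
rewrite mulf_eq0 negb_or => /andP[p1 p2].
have inv_cofactor (u v : R) : v != 0 -> u^-1 = v * (u * v)^-1.
  by move=> v0; rewrite invfM mulrC mulfVK.
rewrite (inv_cofactor (S / 2 + K * t) _ p2) [(K * t - S / 2)^-1](inv_cofactor _ _ p1).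
rewrite [(K * t - S / 2) * (S * _ + _)]mulrC pE.
by field; rewrite S0 q0.
Qed.

Lemma ge0_derive_le0 (f g : R -> R) : (forall x, is_derive x 1 f (g x)) ->
  (forall x, 0 <= x -> 0 <= g x) -> forall x, 0 <= x -> f 0 <= f x.
Proof.
move=> fg g0 x x0.
have df y : derivable f y 1 by exact: (@ex_derive _ _ _ _ _ _ _ (fg y)).
apply: (@ger0_derive1_ndecry _ f 0) => // [y|].
  rewrite in_itv/= andbT => /ltW y0.
  by rewrite derive1E (@derive_val _ _ _ _ _ _ _ (fg y)) g0.
apply: continuous_subspaceT => y.
by apply/differentiable_continuous/derivable1_diffP.
Qed.

Lemma sin_le_id x : 0 <= x -> sin x <= x.
Proof.
move=> x0; rewrite -subr_ge0.
have := @ge0_derive_le0 (fun u => u - sin u) (fun u => 1 - cos u) _ _ x x0.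
by rewrite sin0 subr0; apply=> u _; rewrite subr_ge0 cos_le1.
Qed.

Lemma sin_ge_cubic x : 0 <= x -> x - x ^+ 3 / 6 <= sin x.
Proof.
have cos1 (y : R) : 0 <= y -> 1 - y ^+ 2 / 2 <= cos y.
  move=> y0; rewrite -subr_ge0.
  have := @ge0_derive_le0 (fun u => cos u - (1 - u ^+ 2 / 2)) (fun u => u - sin u) _ _ y y0.
  rewrite cos0 expr0n mul0r subr0 subrr; apply.
    move=> u; apply: is_derive_eq; rewrite /GRing.scale/=; lra.
  by move=> u u0; rewrite subr_ge0 sin_le_id.
move=> x0; rewrite -subr_ge0.
have := @ge0_derive_le0 (fun u => sin u - (u - u ^+ 3 / 6))
  (fun u => cos u - (1 - u ^+ 2 / 2)) _ _ x x0.
rewrite sin0 expr0n mul0r !subr0; apply.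
  move=> u; apply: is_derive_eq; rewrite /GRing.scale/=; lra.
by move=> u u0; rewrite subr_ge0 cos1.
Qed.

(** With x = pi s <= 2, the cubic bound gives sin x >= x/3 and x - sin x <= x^3/6, so the error is
    at most pi x / 2; pi < 4 then yields the constant 8. *)
Lemma inv_sin_bound s : 0 < s <= 2^-1 -> 0 <= pi / sin (pi * s) - s^-1 <= 8 * s.
Proof.
move=> /andP[s0 s2].
have p0 := @pi_gt0 R; have := @pihalf_lt2 R => p4.
set x := pi * s.
have x0 : 0 < x by rewrite mulr_gt0.
have x2 : x <= 2 by rewrite /x; nra.
have x4 : x <= 4 * s by rewrite /x; nra.
have cubic := sin_ge_cubic (ltW x0).
have sinlt : x / 3 <= sin x by apply: le_trans cubic; rewrite exprS expr2; nra.
have sin0 : 0 < sin x by lra.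
have sinle : sin x <= x by exact/sin_le_id/ltW.
have -> : pi / sin x - s^-1 = pi * ((x - sin x) / (x * sin x)).
  have -> : s^-1 = pi / x by rewrite /x invfM mulVKf// lt0r_neq0.
  rewrite -mulrBr; congr (_ * _).
  by field; rewrite !lt0r_neq0.
have q : (x - sin x) / (x * sin x) <= x / 2.
  rewrite ler_pdivrMr ?mulr_gt0//.
  apply: (@le_trans _ _ (x ^+ 3 / 6)); first lra.
  have -> : x ^+ 3 / 6 = x / 2 * (x * (x / 3)) by field.
  by rewrite ler_pM2l ?divr_gt0// ler_pM2l.
apply/andP; split.
  by rewrite mulr_ge0 ?(ltW p0)// divr_ge0 ?subr_ge0// ltW// mulr_gt0.
apply: (le_trans (ler_wpM2l (ltW p0) q)).
nra.
Qed.

(* Iterating the functional equation k times gives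
   [|h s| <= (1 - 3^-k) sup |h| + 3^-k |h (s / 3^k)|], and the last term is
   o(3^-k) because [h] vanishes at 0. *)
Lemma tripling_eq0 h (C : R) :
  (forall s, 0 < s < 1 -> 3 * h s = h (s / 3) - h ((s + 1) / 3) + h ((s + 2) / 3)) ->
  (forall s, 0 < s < 1 -> h (1 - s) = h s) ->
  (forall s, 0 < s <= 2^-1 -> `|h s| <= C * s) ->
  forall s, 0 < s < 1 -> h s = 0.
Proof.
move=> h3 hsym hC.
have C0 : 0 <= C.
  have h2 : 0 < (2^-1 : R) <= 2^-1 by rewrite invr_gt0 ltr0n lexx.
  have := hC _ h2; have := normr_ge0 (h 2^-1); lra.
pose S := [set `|h s| | s in [set s | 0 < s < 1]]%classic.
have ubS : ubound S C.
  move=> _ [s /andP[s0 s1] <-].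
  have [s2|s2] := leP s 2^-1.
    by apply: le_trans (hC _ _) _; [rewrite s0|rewrite ler_piMr// ltW].
  rewrite -hsym ?s0//; apply: le_trans (hC _ _) _; first by apply/andP; split; lra.
  by rewrite ler_piMr//; lra.
have leS s : 0 < s < 1 -> `|h s| <= sup S.
  by move=> s01; apply: ub_le_sup; [exists C|exists s].
have S0 : 0 <= sup S by apply: le_trans (leS 2^-1 _); [|apply/andP; split; lra].
have step k s : 0 < s < 1 -> `|h s| <= (1 - 3 ^- k) * sup S + 3 ^- k * `|h (s / 3 ^+ k)|.
  elim: k s => [|k IH] s s01; first by rewrite expr0 invr1 mulr1 subrr mul0r add0r mul1r.
  apply: le_trans (IH _ s01) _.
  have k0 : 0 < 3 ^- k :> R by rewrite invr_gt0 exprn_gt0.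
  have k1 : 3 ^- k <= 1 :> R by rewrite invf_le1 ?exprn_gt0// exprn_ege1// ler1n.
  set t := s / 3 ^+ k.
  have t01 : 0 < t < 1.
    by case/andP: s01 => s0 s1; rewrite /t; apply/andP; split; nra.
  have -> : s / 3 ^+ k.+1 = t / 3 by rewrite /t exprSr invfM mulrA.
  have -> : 3 ^- k.+1 = 3 ^- k / 3 :> R by rewrite exprSr invfM.
  have t3 : 3 * `|h t| <= `|h (t / 3)| + 2 * sup S.
    have {1}-> : (3 : R) = `|3| by rewrite ger0_norm.
    rewrite -normrM (h3 _ t01).
    have l1 : `|h ((t + 1) / 3)| <= sup S.
      by apply: leS; case/andP: t01 => ? ?; apply/andP; split; lra.
    have l2 : `|h ((t + 2) / 3)| <= sup S.
      by apply: leS; case/andP: t01 => ? ?; apply/andP; split; lra.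
    apply: le_trans (ler_normD _ _) _.
    have := ler_normB (h (t / 3)) (h ((t + 1) / 3)); lra.
  move: k0 k1 t3; set q := 3 ^- k; set u := `|h t|; set w := `|h (t / 3)|; nra.
(* The exponent k + 1 puts s / 3^(k+1) below 1/2, where the linear bound applies. With q = 3^-(k+1)
   this reads sup S <= (1 - q) sup S + q (C q), so sup S <= C q. *)
have small k : sup S <= C / 3 ^+ k.+1.
  have k0 : 0 < 3 ^- k.+1 :> R by rewrite invr_gt0 exprn_gt0.
  have : sup S <= (1 - 3 ^- k.+1) * sup S + 3 ^- k.+1 * (C / 3 ^+ k.+1).
    apply: ge_sup; first by exists `|h 2^-1|; exists 2^-1 => //=; apply/andP; split; lra.
    move=> _ [s s01 <-]; apply: le_trans (step k.+1 s s01) _.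
    rewrite lerD2l; apply: (ler_wpM2l (ltW k0)).
    have k3 : 3 ^- k.+1 <= 3^-1 :> R.
      by rewrite lef_pV2 ?posrE ?exprn_gt0// exprS ler_peMr// exprn_ege1// ler1n.
    case/andP: s01 => s0 s1.
    apply: le_trans (hC _ _) _; first by apply/andP; split; nra.
    by rewrite ler_wpM2l//; nra.
  by rewrite mulrBl mul1r -addrA -[leLHS]addr0 lerD2l addrC subr_ge0 ler_pM2l.
have supS0 : sup S = 0.
  apply/eqP; rewrite eq_le S0 andbT leNgt; apply/negP => Spos.
  have := archi_boundP (divr_ge0 C0 S0); set k := Num.bound _ => kC.
  have := small k; rewrite ler_pdivlMr ?exprn_gt0// mulrC leNgt => /negP; apply.
  rewrite -ltr_pdivrMr//; apply: lt_trans kC _.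
  by rewrite -natrX ltr_nat; apply: (ltn_trans (ltnSn k)); exact: ltn_expl.
move=> s s01; apply/eqP; rewrite -normr_le0 -supS0; exact: leS.
Qed.

Lemma sin_pi_gt0 x : 0 < x < 1 -> 0 < sin (pi * x).
Proof.
move=> /andP[x0 x1]; apply: sin_gt0_pi; rewrite mulr_gt0 ?pi_gt0//=.
by rewrite gtr_pMr ?pi_gt0.
Qed.

Lemma alternating_beta_reflection B s : alternating_beta B -> 0 < s < 1 ->
  B s + B (1 - s) = pi / sin (pi * s).
Proof.
move=> hB s01; apply/eqP; rewrite -subr_eq0; apply/eqP.
apply: (@tripling_eq0 (fun s => B s + B (1 - s) - pi / sin (pi * s)) 16) => // {s s01} s.
- move=> /andP[s0 s1].
  have s1' : 0 < 1 - s by rewrite subr_gt0.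
  have := alternating_beta_triple hB s0; have := alternating_beta_triple hB s1'.
  have -> : (1 - s) / 3 = 1 - (s + 2) / 3 by field.
  have -> : (1 - s + 1) / 3 = 1 - (s + 1) / 3 by field.
  have -> : (1 - s + 2) / 3 = 1 - s / 3 by field.
  have := @inv_sin_triple (pi * (s / 3)).
  have -> : 3 * (pi * (s / 3)) = pi * s by field.
  have -> : pi * (s / 3) + pi / 3 = pi * ((s + 1) / 3) by field.
  have -> : pi * (s / 3) + 2 * (pi / 3) = pi * ((s + 2) / 3) by field.
  rewrite gt_eqF ?sin_pi_gt0 ?s0// => /(_ isT) e.
  have : pi * (3 / sin (pi * s)) = pi * (3 / sin (pi * s)) by [].
  rewrite {1}e; lra.
- by move=> _; rewrite subKr mulrBr mulr1 sinB sinpi cospi mul0r sub0r mulN1r opprK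
    [B (1 - s) + B s]addrC.
(* The functional equation removes the pole 1/s that [B s] shares with the cosecant. The remaining
   [B (1 - s) - B (s + 1)] lies in [0, 4 s], by monotonicity of B and the functional equation at 1 -
   s and 1 + s. *)
- move=> /andP[s0 s2].
  have [B0 Bmono BE] := hB.
  have sb : 0 <= pi / sin (pi * s) - s^-1 <= 8 * s by apply: inv_sin_bound; rewrite s0.
  have s1 : 0 < 1 - s by lra.
  have ss : 0 < 1 + s by lra.
  have e1 := BE _ s0; have e2 := BE _ s1; have e3 := BE _ ss.
  have m1 : B (s + 1) <= B (1 - s) by apply: Bmono => //; lra.
  have m2 : B (1 + s + 1) <= B (1 - s + 1) by apply: Bmono => //; lra.
  have : B (1 - s) - B (s + 1) <= (1 - s)^-1 - (1 + s)^-1.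
    by move: e2 e3 m2; rewrite [in B (1 + s)]addrC; lra.
  have -> : (1 - s)^-1 - (1 + s)^-1 = 2 * s / ((1 - s) * (1 + s)).
    by field; rewrite !lt0r_neq0.
  have : 2 * s / ((1 - s) * (1 + s)) <= 4 * s.
    by rewrite ler_pdivrMr ?mulr_gt0//; nra.
  case/andP: sb => ? ? ? ?; rewrite ler_norml; apply/andP; split; lra.
Qed.

End Herglotz.

(** * Beta and Gamma integrals, and the reflection formula *)

Section Integrals.
Variable R : realType.
Local Open Scope classical_set_scope.
Local Open Scope ereal_scope.
Local Notation mu := (@lebesgue_measure R).

Lemma integral_indic (A : set R) (f : R -> R) :
  \int[mu]_(x in A) (f x)%:E = \int[mu]_x (\1_A x * f x)%:E.
Proof.
rewrite integral_mkcond; apply: eq_integral => x _.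
by rewrite patchE indicE; case: ifPn => _; rewrite ?mul1r// mul0r.
Qed.

Lemma fubini_tonelli_rect (A B : set R) (f : R -> R -> R) :
  measurable A -> measurable B ->
  measurable_fun setT (fun z : R * R => f z.1 z.2) ->
  (forall x y, A x -> B y -> (0 <= f x y)%R) ->
  \int[mu]_(x in A) \int[mu]_(y in B) (f x y)%:E =
  \int[mu]_(y in B) \int[mu]_(x in A) (f x y)%:E.
Proof.
move=> mA mB mf f0.
(* Extension by zero off the rectangle makes the integrand nonnegative on the whole plane, where
   Tonelli's theorem applies. *)
pose g (z : R * R) := (\1_A z.1 * (\1_B z.2 * f z.1 z.2))%R.
have -> : \int[mu]_(x in A) \int[mu]_(y in B) (f x y)%:E =
    \int[mu]_x \int[mu]_y (g (x, y))%:E.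
  rewrite integral_mkcond; apply: eq_integral => x _; rewrite patchE /g/= indicE.
  case: ifPn => _.
    by rewrite integral_indic; apply: eq_integral => y _; rewrite mul1r.
  by rewrite [RHS]integral0_eq// => y _; rewrite mul0r.
have -> : \int[mu]_(y in B) \int[mu]_(x in A) (f x y)%:E =
    \int[mu]_y \int[mu]_x (g (x, y))%:E.
  rewrite integral_mkcond; apply: eq_integral => y _; rewrite patchE /g/= [\1_B y]indicE.
  case: ifPn => _.
    by rewrite integral_indic; apply: eq_integral => x _; rewrite mul1r.
  by rewrite [RHS]integral0_eq// => x _; rewrite mul0r mulr0.
apply: (@fubini_tonelli _ _ _ _ _ mu mu (EFin \o g)).
  apply/measurable_EFinP/measurable_funM.
    by apply: measurableT_comp => //; exact: measurable_indic.
  apply: measurable_funM => //.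
  by apply: measurableT_comp => //; exact: measurable_indic.
move=> [x y]; rewrite /g/= lee_fin !indicE.
have [xA|_] := boolP (x \in A); last by rewrite mul0r.
have [yB|_] := boolP (y \in B); last by rewrite mul0r mulr0.
by rewrite !mul1r f0//; exact/set_mem.
Qed.

(** Multiplication by c pushes Lebesgue measure forward to 1/c times itself; by uniqueness of the
    measure this has to be checked only on half-open intervals. *)
Lemma ge0_integral_scale (c : R) (D : set R) (f : R -> R) : (0 < c)%R ->
  measurable D -> measurable_fun D f -> (forall x, D x -> (0 <= f x)%R) ->
  \int[mu]_(x in D) (f x)%:E =
  c%:E * \int[mu]_(x in [set x | D (c * x)%R]) (f (c * x)%R)%:E.
Proof.
move=> c0 mD mf f0.
have mc : measurable_fun [set: measurableTypeR R] ( *%R c : measurableTypeR R -> measurableTypeR R).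
  exact: mulrl_measurable.
pose cnng := NngNum (ltW c0).
pose nu := mscale cnng
  (measure_function_pushforward__canonical__measure_function_Measure mu mc).
have nuE A : measurable A -> mu A = nu A.
  apply: (@lebesgue_measure_unique R nu) => _ [[a b] _ <-].
  rewrite /nu /mscale/= /pushforward.
  transitivity (c%:E * mu `](a / c)%R, (b / c)%R]); last first.
    congr (_ * mu _); apply/seteqP; split => x /=;
    by rewrite !in_itv/= ltr_pdivrMr// ler_pdivlMr// mulrC.
  rewrite !lebesgue_measure_itv/= !lte_fin ltr_pM2r ?invr_gt0//.
  case: ifPn => _; last by rewrite mule0.
  by rewrite -!EFinD -EFinM -mulrBl mulrCA divff ?mulr1// gt_eqF.
rewrite (eq_measure_integral nu); last by move=> A mA _; exact: nuE.
rewrite ge0_integral_mscale//; last exact/measurable_EFinP.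
rewrite ge0_integral_pushforward//; first exact/measurable_EFinP.
by move=> x /set_mem Dx; rewrite lee_fin f0.
Qed.

Lemma integral_expRN (c : R) : (0 < c)%R ->
  \int[mu]_(x in `]0%R, +oo[) (expR (- (c * x)))%:E = c^-1%:E.
Proof.
move=> c0.
have cc : continuous (fun x : R => expR (- (c * x))).
  move=> x; apply: continuous_comp; last exact: continuous_expR.
  by apply: cvgN; apply: cvgMl_tmp; exact: cvg_id.
rewrite integral_itv_obnd_cbnd; last first.
  by apply/measurable_EFinP; apply: measurable_funTS; exact: continuous_measurable_fun.
rewrite (@ge0_continuous_FTC2y _ _ (fun x => - (c^-1 * expR (- (c * x))))%R _ 0%R).
- by rewrite mulr0 oppr0 expR0 mulr1 EFinN oppeK add0e.
- by move=> x _; rewrite expR_ge0.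
- exact: continuous_subspaceT.
- rewrite -oppr0 -(mulr0 c^-1%R); apply: cvgN; apply: cvgMl_tmp.
  apply: (@cvg_comp _ _ _ (fun x => c * x)%R (fun z : R => expR (- z)) _ (pinfty_nbhs R)); last exact: cvgr_expR.
  exact: gt0_cvgMry.
- move=> x _; exact: ex_derive.
- apply: cvgN; apply: cvgMl_tmp; apply: cvg_at_right_filter; exact: cc.
- move=> x _; rewrite derive1E derive_val /GRing.scale/=.
  field; exact: lt0r_neq0.
Qed.

Lemma is_derive_scale_powR (c p x : R) : (0 < x)%R ->
  is_derive x 1%R (fun y => c * y `^ p)%R (c * (p * x `^ (p - 1)))%R.
Proof.
move=> x0; have dp := is_derive1_powR p x0.
exact: (is_deriveZ c dp).
Qed.

Lemma continuous_powR_gt0 (p x : R) : (0 < x)%R -> {for x, continuous (@powR R ^~ p)}.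
Proof.
move=> x0; apply/differentiable_continuous/derivable1_diffP.
by apply: derivable_powR; rewrite in_itv/= x0.
Qed.

Lemma integral_powR01 (s : R) : (0 < s)%R ->
  \int[mu]_(x in `]0%R, 1%R]) (x `^ (s - 1))%:E = s^-1%:E.
Proof.
move=> s0.
(* The integrand may blow up at 0, so the interval is exhausted by [1/(n+2), 1]; n + 2 keeps these
   nondegenerate already at n = 0. *)
pose e (n : nat) : R := n.+2%:R^-1%R.
have e0 n : (0 < e n)%R by rewrite invr_gt0.
have e1 n : (e n < 1)%R by rewrite invf_lt1 ?ltr1n.
have -> : `]0%R, 1%R]%classic = \bigcup_n `[e n, 1%R]%classic.
  apply/seteqP; split=> [x|x [n _]] /=; rewrite !in_itv/= => /andP[x0 x1]; last first.
    by rewrite x1 (lt_le_trans _ x0).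
  exists (Num.bound x^-1) => //=; rewrite in_itv/= x1 andbT.
  rewrite /e -[leRHS]invrK lef_pV2 ?posrE ?invr_gt0//.
  have x10 : (0 <= x^-1)%R by rewrite invr_ge0 ltW.
  by apply: ltW; apply: lt_le_trans (archi_boundP x10) _; rewrite ler_nat -addn2 leq_addr.
have mf (A : set R) : measurable_fun A (fun x => (x `^ (s - 1))%:E : \bar R).
  by apply/measurable_EFinP; apply: measurable_funTS; exact: measurable_powR.
have cvg1 : \int[mu]_(x in `[e n, 1%R]) (x `^ (s - 1))%:E @[n --> \oo] -->
    (\int[mu]_(x in \bigcup_n `[e n, 1%R]%classic) (x `^ (s - 1))%:E : \bar R).
  apply: ge0_nondecreasing_set_cvg_integral => //.
    move=> m n mn; apply/subsetPset => x /=; rewrite !in_itv/= => /andP[x0 ->].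
    by rewrite andbT (le_trans _ x0)// lef_pV2 ?posrE// ler_nat.
    by move=> n; exact: mf.
  by move=> n x _; rewrite lee_fin powR_ge0.
have cvg2 : \int[mu]_(x in `[e n, 1%R]) (x `^ (s - 1))%:E @[n --> \oo] --> s^-1%:E.
  have -> : (fun n => \int[mu]_(x in `[e n, 1%R]) (x `^ (s - 1))%:E) =
      fun n => (s^-1 - s^-1 * e n `^ s)%:E.
    apply/funext => n.
    rewrite (@continuous_FTC2 _ _ (fun x => s^-1 * x `^ s)%R)//.
    - by rewrite powR1 mulr1 -EFinB.
    - apply: continuous_in_subspaceT => x /set_mem/=; rewrite in_itv/= => /andP[x0 _].
      by apply: continuous_powR_gt0; exact: lt_le_trans x0.
    - split.
      + move=> x; rewrite in_itv/= => /andP[x0 _].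
        by have [] := is_derive_scale_powR s^-1 s (lt_trans (e0 n) x0).
      + by apply: cvg_at_right_filter; apply: cvgMl_tmp; exact: continuous_powR_gt0.
      + by apply: cvg_at_left_filter; apply: cvgMl_tmp; exact: continuous_powR_gt0.
    - move=> x; rewrite in_itv/= => /andP[x0 _].
      have [_ dE] := is_derive_scale_powR s^-1 s (lt_trans (e0 n) x0).
      by rewrite derive1E dE mulKf// gt_eqF.
  apply: cvg_EFin; first exact: nearW.
  rewrite -[X in _ --> X]subr0 -(mulr0 s^-1%R).
  apply: cvgB; first exact: cvg_cst.
  apply: cvgMl_tmp.
  apply: (@cvg_comp _ _ _ e (fun x => x `^ s)%R _ (0%R^'+)); last exact: powR_cvg0.
  have ecvg : e @ \oo --> (0 : R)%R.
    rewrite (_ : e = fun n => harmonic n.+1) ?cvg_shiftS//.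
    exact: cvg_harmonic.
  move=> A eA; apply: (@filterS _ \oo _ (fun n => (0 < e n)%R -> A (e n))).
    by move=> n; apply; exact: e0.
  exact: ecvg eA.
by rewrite -(cvg_lim _ cvg1)// (cvg_lim _ cvg2).
Qed.

Lemma integral_powR1y (s : R) : (0 < s)%R ->
  \int[mu]_(x in `]1%R, +oo[) (x `^ (- s - 1))%:E = s^-1%:E.
Proof.
move=> s0.
rewrite integral_itv_obnd_cbnd; last first.
  by apply/measurable_EFinP; apply: measurable_funTS; exact: measurable_powR.
rewrite (@ge0_continuous_FTC2y _ _ (fun x => - (s^-1 * x `^ (- s)))%R _ 0%R).
- by rewrite powR1 mulr1 EFinN oppeK add0e.
- by move=> x _; rewrite powR_ge0.
- apply: continuous_in_subspaceT => x /set_mem/=; rewrite in_itv/= andbT => x1.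
  by apply: continuous_powR_gt0; exact: lt_le_trans x1.
- rewrite -oppr0 -(mulr0 s^-1%R); apply: cvgN; apply: cvgMl_tmp.
  apply: (@cvg_trans _ ((expR (- (s * ln x))) @[x --> +oo%R])).
    apply: near_eq_cvg; near=> x; rewrite /powR gt_eqF ?mulNr//.
  apply: (@cvg_comp _ _ _ (fun x => s * ln x)%R (fun z : R => expR (- z)) _ (pinfty_nbhs R)); last exact: cvgr_expR.
  apply: gt0_cvgMry => //; apply/cvgryPge => A; near=> x.
  have xA : (expR A <= x)%R by near: x; exact: nbhs_pinfty_ge.
  by rewrite -[A]expRK ler_ln ?posrE ?expR_gt0// (lt_le_trans _ xA)// expR_gt0.
- move=> x x1; apply: derivableN.
  by have [] := is_derive_scale_powR s^-1 (- s) (lt_trans ltr01 x1).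
- by apply: cvgN; apply: cvgMl_tmp; apply: cvg_at_right_filter; exact: continuous_powR_gt0.
- move=> x; rewrite in_itv/= andbT => x1.
  have [dx dE] := is_derive_scale_powR s^-1 (- s) (lt_trans ltr01 x1).
  by rewrite derive1E deriveN// dE mulNr mulrN opprK mulKf// gt_eqF.
Unshelve. all: by end_near. Qed.

(* The inverse is written as a power because [powR] is known to be measurable. *)
Definition beta0 (s : R) := \int[mu]_(u in `]0%R, 1%R]) (u `^ (s - 1) * (1 + u) `^ (-1))%:E.
Definition beta1 (s : R) := \int[mu]_(u in `]1%R, +oo[) (u `^ (- s) * (1 + u) `^ (-1))%:E.

Lemma measurable_beta (p : R) : measurable_fun setT (fun u : R => u `^ p * (1 + u) `^ (-1))%R.
Proof.
apply: measurable_funM; first exact: measurable_powR.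
apply: (measurableT_comp (measurable_powR _)).
exact: measurable_funD.
Qed.

(** Finiteness comes from the functional equation itself: b(s) is one of two nonnegative terms with
    sum 1/s. *)
Lemma alternating_beta_fine (b : R -> \bar R) :
  (forall s, 0 <= b s) ->
  (forall s, (0 < s)%R -> b s + b (s + 1)%R = s^-1%:E) ->
  (forall s t, (0 < s)%R -> (s <= t)%R -> b t <= b s) ->
  alternating_beta (fine \o b) /\ forall s, (0 < s)%R -> b s \is a fin_num.
Proof.
move=> b0 bS bmono.
have bfin s : (0 < s)%R -> b s \is a fin_num.
  move=> s0; rewrite ge0_fin_numE//; apply: le_lt_trans (ltry s^-1).
  by rewrite -bS// leeDl.
split=> //; split=> [s s0|s t s0 st|s s0] /=.
- exact: fine_ge0.
- by apply: fine_le; rewrite ?bfin ?bmono// (lt_le_trans s0).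
- by rewrite -fineD ?bfin ?bS// addr_gt0.
Qed.

(** Adding the integrands at s and s + 1 produces the factor 1 + u, which cancels the
    denominator. *)
Lemma beta0P : alternating_beta (fine \o beta0) /\ forall s, (0 < s)%R -> beta0 s \is a fin_num.
Proof.
have nng p u : (0 <= u `^ p * (1 + u) `^ (-1) :> R)%R by rewrite mulr_ge0 ?powR_ge0.
apply: alternating_beta_fine => [s|s s0|s t s0 st].
- by apply: integral_ge0 => u _; rewrite lee_fin.
- rewrite /beta0 -ge0_integralD//=; last 4 first.
  + by move=> u _; rewrite lee_fin.
  + by apply/measurable_EFinP; apply: measurable_funTS; exact: measurable_beta.
  + by move=> u _; rewrite lee_fin.
  + by apply/measurable_EFinP; apply: measurable_funTS; exact: measurable_beta.
  rewrite -(integral_powR01 s0); apply: eq_integral => u /set_mem/=.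
  rewrite in_itv/= => /andP[u0 _]; rewrite -EFinD; congr EFin.
  rewrite -mulrDl (_ : s + 1 - 1 = s - 1 + 1)%R; last by ring.
  rewrite (@powRD _ u (s - 1) 1) ?(gt_eqF u0) ?implybT// powRr1 ?(ltW u0)//.
  rewrite powR_inv1 ?addr_ge0// ?(ltW u0)//.
  by field; rewrite lt0r_neq0// addr_gt0.
- apply: ge0_le_integral => //=.
  + by move=> u _; rewrite lee_fin.
  + by apply/measurable_EFinP; apply: measurable_funTS; exact: measurable_beta.
  + by apply/measurable_EFinP; apply: measurable_funTS; exact: measurable_beta.
  + move=> u; rewrite in_itv/= => u01; rewrite lee_fin ler_wpM2r ?powR_ge0//.
    by rewrite ger_powR// lerB.
Qed.

(** The substitution u -> 1/u relates [beta1] to [beta0]. Checking the characterising properties a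
    second time replaces it, since [alternating_beta_unique] then identifies the two. *)
Lemma beta1P : alternating_beta (fine \o beta1) /\ forall s, (0 < s)%R -> beta1 s \is a fin_num.
Proof.
have nng p u : (0 <= u `^ p * (1 + u) `^ (-1) :> R)%R by rewrite mulr_ge0 ?powR_ge0.
apply: alternating_beta_fine => [s|s s0|s t s0 st].
- by apply: integral_ge0 => u _; rewrite lee_fin.
- rewrite /beta1 -ge0_integralD//=; last 4 first.
  + by move=> u _; rewrite lee_fin.
  + by apply/measurable_EFinP; apply: measurable_funTS; exact: measurable_beta.
  + by move=> u _; rewrite lee_fin.
  + by apply/measurable_EFinP; apply: measurable_funTS; exact: measurable_beta.
  rewrite -(integral_powR1y s0); apply: eq_integral => u /set_mem/=.
  rewrite in_itv/= andbT => u1; have u0 := lt_trans ltr01 u1.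
  rewrite -EFinD; congr EFin.
  rewrite -mulrDl (_ : - s = - s - 1 + 1)%R; last by ring.
  rewrite (_ : - (s + 1) = - s - 1)%R; last by ring.
  rewrite (_ : - s - 1 + 1 - 1 = - s - 1)%R; last by ring.
  rewrite (@powRD _ u (- s - 1) 1) ?(gt_eqF u0) ?implybT// powRr1 ?(ltW u0)//.
  rewrite powR_inv1 ?addr_ge0// ?(ltW u0)//.
  by field; rewrite lt0r_neq0// addr_gt0.
- apply: ge0_le_integral => //=.
  + by move=> u _; rewrite lee_fin.
  + by apply/measurable_EFinP; apply: measurable_funTS; exact: measurable_beta.
  + by apply/measurable_EFinP; apply: measurable_funTS; exact: measurable_beta.
  + move=> u; rewrite in_itv/= andbT => /ltW u1; rewrite lee_fin ler_wpM2r ?powR_ge0//.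
    by rewrite ler_powR// lerN2.
Qed.

Definition eGamma (s : R) := \int[mu]_(t in `]0%R, +oo[) (t `^ (s - 1) * expR (- t))%:E.

Lemma measurable_Gamma (p : R) : measurable_fun setT (fun t : R => t `^ p * expR (- t))%R.
Proof.
apply: measurable_funM; first exact: measurable_powR.
by apply: measurableT_comp => //; exact: measurable_expR.
Qed.

Lemma ge0_integral_itv0y_split (f : R -> R) : measurable_fun setT f ->
  (forall x, (0 <= f x)%R) ->
  \int[mu]_(x in `]0%R, +oo[) (f x)%:E =
  \int[mu]_(x in `]0%R, 1%R]) (f x)%:E + \int[mu]_(x in `]1%R, +oo[) (f x)%:E.
Proof.
move=> mf f0.
have -> : `]0%R, +oo[%classic = `]0%R, 1%R]%classic `|` `]1%R, +oo[%classic :> set R.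
  apply/seteqP; split=> x /=; rewrite !in_itv/= !andbT.
    by move=> x0; have [x1|x1] := leP x 1%R; [left; apply/andP|right].
  by case=> [/andP[]//|]; exact: lt_trans.
rewrite ge0_integral_setU//=.
- by apply/measurable_EFinP; apply: measurable_funTS.
- by move=> x _; rewrite lee_fin.
- rewrite disj_set2E; apply/eqP/seteqP; split=> // x [] /=.
  by rewrite !in_itv/= andbT => /andP[_ x1]; rewrite ltNge x1.
Qed.

(** For fixed y, the substitution t = y u in the first integral makes all powers of y cancel. After
    exchanging the integrals, the one over y is purely exponential and gives 1/(1 + u). *)
Lemma eGamma_reflection (s : R) : (0 < s < 1)%R ->
  eGamma s * eGamma (1 - s) = beta0 s + beta1 (1 - s).
Proof.
move=> /andP[s0 s1].
have -> : beta0 s + beta1 (1 - s) =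
    \int[mu]_(u in `]0%R, +oo[) (u `^ (s - 1) * (1 + u) `^ (-1))%:E.
  rewrite ge0_integral_itv0y_split; first by rewrite /beta0 /beta1 opprB.
    exact: measurable_beta.
  by move=> x; rewrite mulr_ge0 ?powR_ge0.
have scaled y : (0 < y)%R -> eGamma s * (y `^ (1 - s - 1) * expR (- y))%:E =
    \int[mu]_(u in `]0%R, +oo[) (u `^ (s - 1) * expR (- ((1 + u) * y)))%:E.
  move=> y0; rewrite /eGamma (ge0_integral_scale y0)//; last 2 first.
    by apply: measurable_funTS; exact: measurable_Gamma.
    by move=> x _; rewrite mulr_ge0 ?powR_ge0 ?expR_ge0.
  have -> : [set x | `]0%R, +oo[%classic (y * x)%R] = `]0%R, +oo[%classic :> set R.
    by apply/seteqP; split=> x /=; rewrite !in_itv/= !andbT pmulr_rgt0.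
  rewrite muleC muleA -EFinM -ge0_integralZl//=; last 3 first.
  - apply/measurable_EFinP; apply: measurable_funTS.
    apply: (measurableT_comp (measurable_Gamma _)); exact: mulrl_measurable.
  - by move=> x _; rewrite lee_fin mulr_ge0 ?powR_ge0 ?expR_ge0.
  - by rewrite lee_fin mulr_ge0 ?(ltW y0)// mulr_ge0 ?powR_ge0 ?expR_ge0.
  apply: eq_integral => u /set_mem/=; rewrite in_itv/= andbT => u0.
  rewrite -EFinM; congr EFin; rewrite powRM ?(ltW y0) ?(ltW u0)//.
  rewrite (_ : - ((1 + u) * y) = - y + - (y * u))%R; last by ring.
  rewrite expRD.
  have : (y `^ (1 - s - 1) * y * y `^ (s - 1) = 1)%R.
    rewrite -{2}(powRr1 (ltW y0)) -!powRD ?(gt_eqF y0) ?implybT//.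
    by rewrite (_ : _ + _ = 0)%R ?powRr0//; ring.
  move: (y `^ _)%R (y `^ _)%R (expR _) (expR _) => a b c d e.
  by rewrite -[RHS]mul1r -e; ring.
rewrite [eGamma (1 - s)]/eGamma -ge0_integralZl//=; last 3 first.
- by apply/measurable_EFinP; apply: measurable_funTS; exact: measurable_Gamma.
- by move=> x _; rewrite lee_fin mulr_ge0 ?powR_ge0 ?expR_ge0.
- by apply: integral_ge0 => x _; rewrite lee_fin mulr_ge0 ?powR_ge0 ?expR_ge0.
transitivity (\int[mu]_(y in `]0%R, +oo[) \int[mu]_(u in `]0%R, +oo[)
    (u `^ (s - 1) * expR (- ((1 + u) * y)))%:E).
  by apply: eq_integral => y /set_mem/=; rewrite in_itv/= andbT => /scaled.
rewrite (@fubini_tonelli_rect _ _ (fun y u => u `^ (s - 1) * expR (- ((1 + u) * y)))%R)//.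
- apply: eq_integral => u /set_mem/=; rewrite in_itv/= andbT => u0.
  have u1 : (0 < 1 + u)%R by rewrite addr_gt0.
  under eq_integral do rewrite EFinM.
  rewrite ge0_integralZl//=.
  + by rewrite integral_expRN// -EFinM powR_inv1// ltW.
  + apply/measurable_EFinP; apply: measurable_funTS; apply: measurableT_comp => //.
    by apply: measurableT_comp => //; exact: mulrl_measurable.
  + by rewrite lee_fin powR_ge0.
- apply: measurable_funM.
    by apply: (measurableT_comp (measurable_powR _)); exact: measurable_snd.
  apply: measurableT_comp => //; apply: measurableT_comp => //.
  apply: measurable_funM; last exact: measurable_fst.
  by apply: measurable_funD => //; exact: measurable_snd.
- by move=> y u _ _; rewrite mulr_ge0 ?powR_ge0 ?expR_ge0.
Qed.

(** Allows [fine] to be distributed over the product in the reflection formula. The integrand is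
    dominated by t^(s-1) up to 1 and, as s < 1, by exp(-t) beyond. *)
Lemma eGamma_fin_num (s : R) : (0 < s < 1)%R -> eGamma s \is a fin_num.
Proof.
move=> /andP[s0 s1].
have ge0 t : (0 <= t `^ (s - 1) * expR (- t) :> R)%R.
  by rewrite mulr_ge0 ?powR_ge0 ?expR_ge0.
have mG (A : set R) : measurable_fun A (fun t => (t `^ (s - 1) * expR (- t))%:E).
  by apply/measurable_EFinP; apply: measurable_funTS; exact: measurable_Gamma.
have mE (A : set R) : measurable_fun A (fun t : R => (expR (- t))%:E).
  by apply/measurable_EFinP; apply: measurable_funTS; apply: measurableT_comp.
rewrite ge0_fin_numE; last by apply: integral_ge0 => t _; rewrite lee_fin.
rewrite /eGamma ge0_integral_itv0y_split//; last exact: measurable_Gamma.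
apply: (@le_lt_trans _ _ (s^-1%:E + 1^-1%:E)); last exact: ltry.
apply: leeD.
- rewrite -(integral_powR01 s0); apply: ge0_le_integral => //=.
  + by move=> t _; rewrite lee_fin.
  + exact: mG.
  + by apply/measurable_EFinP; apply: measurable_funTS; exact: measurable_powR.
  + move=> t; rewrite in_itv/= => /andP[t0 _]; rewrite lee_fin ler_piMr ?powR_ge0//.
    by rewrite -expR0 ler_expR oppr_le0 ltW.
- rewrite -(@integral_expRN 1)// ge0_integral_itv0y_split; last 2 first.
  + apply: measurableT_comp => //.
    by apply: measurableT_comp => //; exact: mulrl_measurable.
  + by move=> t; rewrite expR_ge0.
  apply: le_trans (leeDr _ _); last first.
    by apply: integral_ge0 => t _; rewrite lee_fin expR_ge0.
  under [leRHS]eq_integral do rewrite mul1r.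
  apply: ge0_le_integral => //=.
  + by move=> t _; rewrite lee_fin.
  + exact: mG.
  + exact: mE.
  + move=> t; rewrite in_itv/= andbT => t1; rewrite lee_fin ler_piMl ?expR_ge0//.
    by rewrite -[leRHS](powRr0 t) ler_powR ?(ltW t1)// subr_le0 ltW.
Qed.

Lemma Gamma_reflection (s : R) : (0 < s < 1)%R ->
  (Gamma s * Gamma (1 - s) = pi / sin (pi * s))%R.
Proof.
move=> s01; have s01' : (0 < 1 - s < 1)%R by lra.
have GE t : Gamma t = fine (eGamma t).
  rewrite /Gamma /Rintegral /eGamma; congr (fine (integral _ _ _)).
  by apply/seteqP; split=> x /=; rewrite in_itv/= andbT.
have /andP[s0 s1] := s01.
have := eGamma_reflection s01.
rewrite !GE -fineM ?eGamma_fin_num// => ->.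
have [hb0 fb0] := beta0P; have [hb1 fb1] := beta1P.
rewrite fineD ?fb0 ?fb1 ?subr_gt0//.
rewrite -(alternating_beta_reflection hb0 s01); congr (_ + _)%R.
by apply/esym/(alternating_beta_unique hb0 hb1); rewrite subr_gt0.
Qed.

End Integrals.

(** * The polynomials phi_n and the Euler form *)

Section Combinatorics.
Variable a : nat -> nat.
Hypothesis a_ge2 : forall i, (1 <= i)%N -> (2 <= a i)%N.

Lemma d0 : d a 0 = 1%N.
Proof. by rewrite /d big_nil. Qed.

Lemma dS n : d a n.+1 = (d a n * a n.+1)%N.
Proof. by rewrite /d big_nat_recr. Qed.

Lemma d_gt0 n : (0 < d a n)%N.
Proof. by elim: n => [|n IH]; rewrite ?d0// dS muln_gt0 IH ltnW ?a_ge2. Qed.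

Lemma dvdn_d m n : (m <= n)%N -> (d a m %| d a n)%N.
Proof.
move=> mn; rewrite -(subnKC mn); elim: (n - m)%N => [|k IH]; first by rewrite addn0.
by rewrite addnS dS dvdn_mulr.
Qed.

Lemma big_multiples (T : nmodType) (b D : nat) (F : nat -> T) : (0 < b)%N ->
  \sum_(1 <= k < (D * b).+1 | (b %| k)%N) F k = \sum_(1 <= k < D.+1) F (b * k)%N.
Proof.
move=> b0; rewrite big_mkcond; elim: D => [|D IH]; first by rewrite mul0n !big_nil.
rewrite [RHS]big_nat_recr//= -IH (big_cat_nat (n := (D * b).+1) (p := (D.+1 * b).+1))//=; last first.
  by rewrite mulSn; lia.
congr (_ + _); rewrite mulSn addnC big_nat_recr/=; last by lia.
rewrite big_nat_cond big1 ?add0r; last first.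
  move=> k /andP[/andP[k1 k2] _]; case: ifP => // /dvdnP[c kE].
  have : (D * b < c * b < D.+1 * b)%N by rewrite -kE k1 mulSnr.
  rewrite !ltn_mul2r b0/=; lia.
by rewrite -mulSnr dvdn_mull// mulnC.
Qed.

Lemma cntS n : (cnt a n.+1 + d a n = d a n.+1)%N.
Proof.
have an : (0 < a n.+1)%N by rewrite ltnW ?a_ge2.
rewrite /cnt /Iprime size_filter; set s := iota _ _.
rewrite -[RHS](size_iota 1) -/s -(count_predC (fun k => a n.+1 %| k)%N s) addnC.
congr (_ + _)%N.
have -> : count (fun k => a n.+1 %| k)%N s = \sum_(1 <= k < (d a n * a n.+1).+1 | (a n.+1 %| k)%N) 1%N.
  by rewrite -sum1_count /s dS /index_iota subn1.
by rewrite big_multiples// sum_nat_const_nat subn1 muln1.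
Qed.

(** Together with [mu a 0 = 1], this recursion identifies |I_n| with the alternating sum of the
    d_i. *)
Lemma muS n : (mu a n.+1 + mu a n = d a n.+1)%N.
Proof.
elim: n => [|n IH]; first by rewrite -cntS d0.
by rewrite -cntS -IH/= -addnA [(mu a n + _)%N]addnC.
Qed.

Lemma leq_mu_d n : (mu a n <= d a n)%N.
Proof. by case: n => [|n]; rewrite ?d0// -muS leq_addr. Qed.

(* [psi n] is the polynomial phi_(n-1), with the convention phi_(-1) = 1. *)
Fixpoint psi (K : nzRingType) (n : nat) : {poly K} :=
  match n with
  | 0 => 1
  | 1 => 1 - 'X
  | m.+2 => psi K m * \sum_(i < a m.+1) 'X^(d a m) ^+ i
  end.

Lemma psiSS (K : nzRingType) n :
  psi K n.+2 = psi K n * \sum_(i < a n.+1) 'X^(d a n) ^+ i.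
Proof. by []. Qed.

(** The new geometric factor turns 1 - t^(d_n) into 1 - t^(d_(n+1)). At t = N, with N^(d_n) = 0,
    this says that phi_(n-1)(N) and phi_n(N) are inverse to each other. *)
Lemma psi_mul (K : comNzRingType) n : psi K n * psi K n.+1 = 1 - 'X^(d a n).
Proof.
elim: n => [|n IH]; first by rewrite d0 expr1 mul1r.
rewrite psiSS mulrA [psi K n.+1 * _]mulrC IH dS exprM.
by rewrite -opprB mulNr -subrX1 opprB.
Qed.

Lemma size_psiS (K : nzRingType) n : (size (psi K n.+1) <= (mu a n).+1)%N.
Proof.
suff [] : (size (psi K n.+1) <= (mu a n).+1)%N /\ (size (psi K n.+2) <= (mu a n.+1).+1)%N by [].
have geom m : (size (\sum_(i < a m.+1) 'X^(d a m) ^+ i : {poly K})%R <= (cnt a m.+1).+1)%N.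
  apply: (leq_trans (size_sum _ _ _)); apply/bigmax_leqP => i _.
  rewrite -exprM size_polyXn ltnS -(leq_add2r (d a m)) cntS dS.
  by rewrite -mulnSr leq_mul2l ltn_ord orbT.
elim: n => [|n [IH1 IH2]]; split=> //.
- by apply: (leq_trans (size_polyD _ _)); rewrite size_polyN size_polyX size_poly1.
- by rewrite psiSS mul1r; exact: geom.
- rewrite psiSS -[mu a n.+2]/(cnt a n.+2 + mu a n)%N.
  apply: (leq_trans (size_polyMleq _ _)); have := geom n.+1; lia.
Qed.

Lemma size_psi (K : nzRingType) n : (size (psi K n) + mu a n <= (d a n).+1)%N.
Proof.
case: n => [|n]; first by rewrite size_poly1 d0.
by rewrite -muS addnC -addnS leq_add2l size_psiS.
Qed.

(* The alternating product is only used through its two-step recursion, which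
   avoids inverting whole partial products. *)
Lemma psi_alternating_prod (K : nzRingType) (A : unitRingType)
  (f : {rmorphism {poly K} -> A}) n :
  (forall i, (i < n)%N -> 1 - f 'X ^+ d a i \is a GRing.unit) ->
  \prod_(i < n) (if odd (n - i) then 1 - f 'X ^+ d a i else (1 - f 'X ^+ d a i)^-1)
  = f (psi K n).
Proof.
set x := f 'X.
suff [] : ((forall i, (i < n)%N -> 1 - x ^+ d a i \is a GRing.unit) ->
  \prod_(i < n) (if odd (n - i) then 1 - x ^+ d a i else (1 - x ^+ d a i)^-1)
    = f (psi K n)) /\
  ((forall i, (i < n.+1)%N -> 1 - x ^+ d a i \is a GRing.unit) ->
  \prod_(i < n.+1) (if odd (n.+1 - i) then 1 - x ^+ d a i else (1 - x ^+ d a i)^-1)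
    = f (psi K n.+1)) by [].
elim: n => [|n [IH1 IH2]]; split=> //.
- by rewrite big_ord0 rmorph1.
- by rewrite big_ord1 d0 expr1 rmorphB rmorph1.
move=> xu; rewrite psiSS rmorphM -IH1; last first.
  by move=> i ni; apply: xu; rewrite ltnW// ltnW.
rewrite 2!big_ord_recr/= -mulrA; congr (_ * _).
  apply: eq_bigr => i _; have ni := ltnW (ltn_ord i).
  by rewrite (subSn (leqW ni)) (subSn ni)/= negbK.
rewrite subSnn (subSn (leqnSn n)) subSnn/=.
have -> : f (\sum_(i < a n.+1) 'X^(d a n) ^+ i) = \sum_(i < a n.+1) (x ^+ d a n) ^+ i.
  rewrite (rmorph_sum f); apply: eq_bigr => i _.
  by etransitivity; [exact: rmorphXn|congr (_ ^+ _); exact: rmorphXn].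
have un := xu n (ltnW (ltnSn n.+1)).
apply: (mulrI un); rewrite mulrA mulrV// mul1r.
by rewrite dS exprM -opprB subrX1 -mulNr opprB.
Qed.

(** * The Euler form as a polynomial in the nilpotent shift *)

Section EulerForm.
Variable R : realType.
Local Notation C := (R[i]).

Lemma shiftX m k :
  shiftN R m.+1 ^+ k = \matrix_(i, j) ((i + k)%N == j :> nat)%:R.
Proof.
elim: k => [|k IH]; apply/matrixP => i j.
  by rewrite expr0 !mxE addn0.
rewrite exprSr IH !mxE.
have [ik|ik] := ltnP (i + k) m.+1; last first.
  rewrite (_ : (_ == _)%N = false); last by have := ltn_ord j; lia.
  rewrite big1// => l _; rewrite !mxE (_ : (_ == _)%N = false) ?mul0r//.
  by have := ltn_ord l; lia.
rewrite (bigD1 (Ordinal ik))//= !mxE eqxx mul1r big1 ?addr0 ?addnS// => l /eqP li.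
rewrite !mxE (_ : (i + k == l)%N = false) ?mul0r//; apply/eqP => e; apply: li.
exact/val_inj.
Qed.

Lemma mxpow_shift m k : mxpow (shiftN R m.+1) k = shiftN R m.+1 ^+ k.
Proof.
by elim: k => [|k IH]; [rewrite expr0 | rewrite exprS -IH].
Qed.

Lemma shiftX_eq0 m k : (m < k)%N -> shiftN R m.+1 ^+ k = 0.
Proof.
move=> mk; rewrite shiftX; apply/matrixP => i j; rewrite !mxE.
by rewrite (_ : (_ == _)%N = false)//; have := ltn_ord j; lia.
Qed.

Lemma subr1_shiftX_unit m k : (0 < k)%N -> 1 - shiftN R m.+1 ^+ k \is a GRing.unit.
Proof.
move=> k0; set M := shiftN R m.+1.
have e : (1 - M ^+ k) *m (\sum_(i < m.+1) (M ^+ k) ^+ i) = 1%:M.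
  rewrite -[LHS]/((1 - M ^+ k) * _) -opprB mulNr -subrX1 opprB -exprM.
  by rewrite shiftX_eq0 ?subr0// leq_pmull.
by have [] := mulmx1_unit e.
Qed.

Lemma horner_shift m (p : {poly C}) (i j : 'I_m.+1) :
  horner_mx (shiftN R m.+1) p i j = if (i <= j)%N then p`_(j - i) else 0.
Proof.
have -> : horner_mx (shiftN R m.+1) p = \sum_(k < size p) p`_k *: shiftN R m.+1 ^+ k.
  rewrite -{1}[p]coefK poly_def (rmorph_sum (horner_mx _)); apply: eq_bigr => k _ /=.
  by rewrite horner_mxZ (rmorphXn (horner_mx _))/= horner_mx_X.
rewrite summxE; under eq_bigr do rewrite !mxE shiftX mxE.
case: leqP => ij; last first.
  by rewrite big1// => k _; rewrite (_ : (_ == _)%N = false) ?mulr0//; lia.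
have [sp|sp] := leqP (size p) (j - i).
  rewrite nth_default// big1// => k _.
  by rewrite (_ : (_ == _)%N = false) ?mulr0//; have := ltn_ord k; lia.
rewrite (bigD1 (Ordinal sp))//= subnKC// eqxx mulr1 big1 ?addr0// => k /eqP kE.
rewrite (_ : (_ == _)%N = false) ?mulr0//; apply/eqP => ik; apply: kE.
by apply/val_inj => /=; lia.
Qed.

(** The size is a successor because only then do the square matrices form a nonzero ring, in which
    [psi_alternating_prod] can be evaluated. *)
Lemma chim_horner_aux n m : (m < d a n)%N ->
  \big[mulmx/1%:M]_(i < n.+1)
    (if odd (n - i) then 1%:M - mxpow (shiftN R m.+1) (d a i)
     else invmx (1%:M - mxpow (shiftN R m.+1) (d a i))) =
  horner_mx (shiftN R m.+1) (psi C n).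
Proof.
move=> mn; set M := shiftN R m.+1.
transitivity (\prod_(i < n.+1)
    (if odd (n - i) then 1 - M ^+ d a i else (1 - M ^+ d a i)^-1)).
  by apply: eq_bigr => i _; rewrite mxpow_shift.
(* The factor i = n is trivial since N^(d_n) = 0; the other n factors make up phi_(n-1). *)
rewrite big_ord_recr/= subnn/= shiftX_eq0// subr0 invr1 mulr1.
have := @psi_alternating_prod C 'M[C]_m.+1 (horner_mx M) n; rewrite /= horner_mx_X; apply.
by move=> i _; apply: subr1_shiftX_unit; exact: d_gt0.
Qed.

Lemma chimE n i j :
  chim R a n i j = if (i <= j)%N then (psi C n)`_(j - i) else 0.
Proof.
rewrite /chim; have := leq_mu_d n; move: (mu a n) i j => [[]//|m] i j md.
by rewrite chim_horner_aux// horner_shift.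
Qed.

Lemma chim_unit n : chim R a n \in unitmx.
Proof.
rewrite /chim; have := leq_mu_d n; case: (mu a n) => [|m] md.
  by rewrite unitmxE det_mx00 unitr1.
rewrite chim_horner_aux//.
have e : horner_mx (shiftN R m.+1) (psi C n) *m horner_mx (shiftN R m.+1) (psi C n.+1) = 1%:M.
  rewrite -[LHS](rmorphM (horner_mx _)) psi_mul rmorphB rmorph1 (rmorphXn (horner_mx _))/=.
  by rewrite horner_mx_X shiftX_eq0// subr0.
by have [] := mulmx1_unit e.
Qed.

End EulerForm.

End Combinatorics.

(** * Pairing kappa with d_n - kappa *)

Section Exponential.
Variable R : realType.
Local Notation C := (R[i]).
Implicit Types x y : R.
Local Open Scope complex_scope.

Lemma ee0 : ee (0 : R) = 1.
Proof. by rewrite /ee mulr0 cos0 sin0. Qed.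

Lemma eeD x y : ee (x + y) = ee x * ee y.
Proof.
by rewrite /ee mulrDr cosD sinD; simpc; congr (_ +i* _); rewrite addrC.
Qed.

Lemma ee_mulVr x : ee x * ee (- x) = 1.
Proof. by rewrite -eeD subrr ee0. Qed.

Lemma ee_unit x : ee x \is a GRing.unit.
Proof. by apply/unitrPr; exists (ee (- x)); exact: ee_mulVr. Qed.

Lemma eeN x : ee (- x) = (ee x)^-1.
Proof. by apply: (mulrI (ee_unit x)); rewrite ee_mulVr divrr ?ee_unit. Qed.

Lemma ee_sum (I : Type) (r : seq I) (P : pred I) (F : I -> R) :
  ee (\sum_(i <- r | P i) F i) = \prod_(i <- r | P i) ee (F i).
Proof. exact: (big_morph _ eeD ee0). Qed.

Lemma ee_natmul x k : ee (x * k%:R) = ee x ^+ k.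
Proof.
elim: k => [|k IH]; first by rewrite mulr0 ee0.
by rewrite -natr1 mulrDr mulr1 eeD IH exprSr.
Qed.

Lemma ee_nat k : ee (k%:R : R) = 1.
Proof.
rewrite -[k%:R]mul1r ee_natmul /ee mulr1 (_ : 2 * pi = pi *+ 2); last by rewrite mulr_natl.
by rewrite cos2pi sin2pi expr1n.
Qed.

Lemma ee_int (z : int) : ee (z%:~R : R) = 1.
Proof.
case: z => k; first exact: ee_nat.
by rewrite NegzE mulrNz eeN ee_nat invr1.
Qed.

Lemma ee_congr x y (z : int) : x - y = z%:~R -> ee x = ee y.
Proof. by move=> xy; rewrite -[x](subrK y) xy eeD ee_int mul1r. Qed.

(** Half-angle form: the first factor is i exp(i pi x). *)
Lemma ee_half x : ee x - 1 = (- sin (pi * x) +i* cos (pi * x)) * (2 * sin (pi * x))%:C.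
Proof.
rewrite /ee (_ : 2 * pi * x = (pi * x) *+ 2); last by ring.
rewrite cos_mulr2n sin_mulr2n cos2sin2; simpc.
by congr (_ +i* _); ring.
Qed.

Lemma ee_neq1 x : 0 < x < 1 -> ee x != 1.
Proof.
move=> x01; have s0 := sin_pi_gt0 x01.
rewrite -subr_eq0 ee_half mulf_neq0//.
  by rewrite eq_complex/= negb_and oppr_eq0 gt_eqF.
by rewrite eq_complex/= negb_and gt_eqF// mulr_gt0.
Qed.

Lemma ee_eq1 x : ee x = 1 -> exists z : int, x = z%:~R.
Proof.
move=> x1; exists (Num.floor x); apply/eqP; apply: contraPT x1 => xf.
apply/eqP; rewrite (@ee_congr _ (x - (Num.floor x)%:~R) (Num.floor x)) ?subKr//.
apply: ee_neq1; have := floor_le x; have := floorD1_gt x; rewrite intrD.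
by move: xf; rewrite eq_sym => xf *; apply/andP; split; [rewrite subr_gt0 lt_neqAle xf|lra].
Qed.

(* The Gamma factors of c_kappa and c_(d_n - kappa), the half-integer twist and
   the factor 1/(2 pi) combine into 1 / (1 - e[-w]) by the reflection formula. *)
Lemma ee_Gamma_factor x : 0 < x < 1 ->
  ((2 * pi)^-1 * (Gamma (1 - x) * Gamma x))%:C * ee (2^-1 * (x - 2^-1)) * (1 - ee (- x)) = 1.
Proof.
move=> x01; have s0 := sin_pi_gt0 x01.
rewrite [Gamma (1 - x) * _]mulrC (Gamma_reflection x01).
have -> : 1 - ee (- x) = (sin (pi * x) +i* cos (pi * x)) * (2 * sin (pi * x))%:C.
  rewrite -[LHS]opprB ee_half mulrN sinN cosN opprK -mulrN -rmorphN.
  by congr (_ * _%:C); ring.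
have -> : ee (2^-1 * (x - 2^-1)) = sin (pi * x) +i* (- cos (pi * x)).
  rewrite /ee (_ : 2 * pi * (2^-1 * (x - 2^-1)) = pi * x - pi / 2); last by field.
  by rewrite cosBpihalf sinBpihalf.
have e : (2 * pi)^-1 * (pi / sin (pi * x)) = (2 * sin (pi * x))^-1.
  by rewrite !invfM -mulrA mulKf ?gt_eqF ?pi_gt0.
rewrite e; set s := sin _ in s0 *; set c := cos _.
have sc : c ^+ 2 + s ^+ 2 = 1 by exact: cos2Dsin2.
have sc1 : (s +i* - c) * (s +i* c) = 1.
  by simpc; rewrite -!expr2 addrC sc mulrC addrC addNr.
have e1 : (2 * s)^-1%:C * (2 * s)%:C = 1.
  by rewrite -rmorphM /= mulVf ?gt_eqF ?mulr_gt0.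
have regroup (u v w z : C) : u * v * (w * z) = (u * z) * (v * w) by ring.
by rewrite regroup e1 sc1 mulr1.
Qed.

End Exponential.

(** * The exponents omega and the entries of ch_Gamma in terms of roots of unity *)

Section Omega.
Variables (R : realType) (a : nat -> nat).
Hypothesis a_ge2 : forall i, (1 <= i)%N -> (2 <= a i)%N.
Local Notation C := (R[i]).
Local Open Scope complex_scope.
Local Notation omega := (@omega R a).

Definition omega_arg (n kappa l : nat) : R :=
  (-1) ^+ l.-1 * (d a l.-1)%:R / (d a n)%:R * kappa%:R.

(* The exponent [n.+1] has the parity of [n - 1] without truncating at [n = 0]. *)
Definition unitroot (n kappa : nat) : C := ee ((-1) ^+ n.+1 * kappa%:R / (d a n)%:R).

Lemma dR_neq0 n : (d a n)%:R != 0 :> R.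
Proof. by rewrite pnatr_eq0 -lt0n d_gt0. Qed.

Lemma mem_Iprime n k : (k \in Iprime a n) = [&& 1 <= k, k <= d a n & ~~ (a n %| k)]%N.
Proof.
by rewrite mem_filter mem_iota add1n ltnS andbC andbA.
Qed.

Lemma Iprime_compl n k : (1 <= n)%N -> k \in Iprime a n -> (d a n - k)%N \in Iprime a n.
Proof.
case: n => // n _; rewrite !mem_Iprime => /and3P[k1 kd ak].
have kd' : k != d a n.+1.
  by apply: contraNneq ak => ->; rewrite dS dvdn_mull.
apply/and3P; split; [lia|lia|].
by rewrite dvdn_subr// dS dvdn_mull.
Qed.

Lemma omegaE n k l : omega n k l = omega_arg n k l - (Num.floor (omega_arg n k l))%:~R.
Proof. by []. Qed.

(** An integral value would make d_n divide d_(l-1) k. As l - 1 < n, d_(l-1) a_n divides d_n, so a_n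
    would divide k, contrary to the definition of I'_n. *)
Lemma omega_arg_nint n k l (z : int) : (1 <= l <= n)%N -> k \in Iprime a n ->
  omega_arg n k l != z%:~R.
Proof.
move=> /andP[l1 ln]; rewrite mem_Iprime => /and3P[k1 kd ak].
apply: contra ak => /eqP xz.
have e : (d a l.-1 * k = `|z| * d a n)%N.
  apply/eqP; rewrite -(eqr_nat R) !natrM natr_absz intr_norm -xz.
  rewrite /omega_arg !normrM normfV !normr_nat normr_sign mul1r.
  by rewrite mulrAC divfK ?dR_neq0.
case: n => [|n] in ln xz e kd *; first by move: l1; rewrite leqNgt ltnS ln.
have : (d a l.-1 * a n.+1 %| d a l.-1 * k)%N.
  rewrite e dvdn_mull// dS dvdn_mul// dvdn_d//.
  by rewrite -ltnS prednK.
by rewrite dvdn_pmul2l// d_gt0.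
Qed.

Lemma omega_bounds n k l : (1 <= l <= n)%N -> k \in Iprime a n -> 0 < omega n k l < 1.
Proof.
move=> ln kI; rewrite omegaE; have := omega_arg_nint (Num.floor (omega_arg n k l)) ln kI.
have := floor_le (omega_arg n k l); have := floorD1_gt (omega_arg n k l).
rewrite intrD => lt1 le0 ne; apply/andP; split; last by lra.
by rewrite subr_gt0 lt_neqAle eq_sym ne.
Qed.

Lemma omega_compl n k l : (1 <= l <= n)%N -> k \in Iprime a n ->
  omega n (d a n - k) l = 1 - omega n k l.
Proof.
move=> ln kI; have := omega_bounds ln kI; rewrite !omegaE.
have kd : (k <= d a n)%N by move: kI; rewrite mem_Iprime => /and3P[].
have -> : omega_arg n (d a n - k) l = ((-1) ^+ l.-1 * (d a l.-1)%:Z)%:~R - omega_arg n k l.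
  rewrite /omega_arg natrB// mulrBr divfK ?dR_neq0//.
  by rewrite intrM rmorphXn rmorphN1.
set x := omega_arg n k l; set z := (-1) ^+ l.-1 * _ => x01.
have -> : Num.floor (z%:~R - x) = z - Num.floor x - 1.
  by apply: floor_def; rewrite subrK !intrD !rmorphN/=; apply/andP; split; lra.
by rewrite !intrD !rmorphN/=; ring.
Qed.

(** Modulo 1, omega_l is (-1)^(n-l) d_(l-1) times the exponent of u. The parity test is the one that
    separates numerator from denominator factors of phi_(n-1). *)
Lemma ee_omega n k l : (1 <= l <= n)%N ->
  (if odd (n - l.-1) then ee (omega n k l) else ee (- omega n k l)) = unitroot n k ^+ d a l.-1.
Proof.
move=> /andP[l1 ln]; rewrite /unitroot -ee_natmul.
have sg : (-1) ^+ n.+1 = (if odd (n - l.-1) then 1 else -1) * (-1) ^+ l.-1 :> R.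
  rewrite -signr_odd -[X in _ * X]signr_odd oddS oddB; last by lia.
  by case: (odd n); case: (odd l.-1); rewrite /= ?mul1r ?expr1 ?expr0 ?mulr1 ?mulN1r ?opprK.
have -> : (-1) ^+ n.+1 * k%:R / (d a n)%:R * (d a l.-1)%:R =
  (if odd (n - l.-1) then 1 else -1) * omega_arg n k l.
  by rewrite sg /omega_arg; field; rewrite dR_neq0.
rewrite omegaE; case: ifP => _.
  rewrite mul1r; apply/esym/(@ee_congr _ _ _ (Num.floor (omega_arg n k l))).
  by rewrite subKr.
rewrite mulN1r; apply: (@ee_congr _ _ _ (Num.floor (omega_arg n k l))).
by rewrite opprK opprB subrK.
Qed.

Lemma unitroot_unity n k : unitroot n k ^+ d a n = 1.
Proof.
rewrite /unitroot -ee_natmul divfK ?dR_neq0//.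
have -> : (-1) ^+ n.+1 * k%:R = ((-1) ^+ n.+1 * k%:Z)%:~R :> R.
  by rewrite intrM rmorphXn rmorphN1.
exact: ee_int.
Qed.

Lemma subr1_unitrootX_neq0 n k l : (1 <= l <= n)%N -> k \in Iprime a n -> 1 - unitroot n k ^+ d a l.-1 != 0.
Proof.
move=> ln kI; rewrite -ee_omega// subr_eq0 eq_sym.
have w01 := omega_bounds ln kI.
case: ifP => _; first exact: ee_neq1.
by rewrite eeN invr_eq1 ee_neq1.
Qed.

(** Both parity cases in the definition of [cc] range over the l <= n congruent to n modulo 2, so
    they merge into one product over all l. *)
Lemma prod_parity (T : comNzRingType) (n : nat) (G : nat -> T) :
  \prod_(1 <= l < n.+1) (if odd (n - l.-1) then G l else 1) =
  if odd n then \prod_(1 <= i < (n.+1)./2 .+1) G (2 * i).-1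
  else \prod_(1 <= i < n./2 .+1) G (2 * i)%N.
Proof.
suff [] : (\prod_(1 <= l < n.+1) (if odd (n - l.-1) then G l else 1) =
  (if odd n then \prod_(1 <= i < (n.+1)./2 .+1) G (2 * i).-1
  else \prod_(1 <= i < n./2 .+1) G (2 * i)%N)) /\
  (\prod_(1 <= l < n.+2) (if odd (n.+1 - l.-1) then G l else 1) =
  if odd n.+1 then \prod_(1 <= i < (n.+2)./2 .+1) G (2 * i).-1
  else \prod_(1 <= i < (n.+1)./2 .+1) G (2 * i)%N) by [].
elim: n => [|n [IH1 IH2]]; split=> //.
- by rewrite !big_nil.
- by rewrite /= !big_nat1.
rewrite 2!(big_nat_recr _ _ _ (ltn0Sn _))/= subSnn (subSn (leqnSn n)) subSnn/= mulr1.
have -> : \prod_(1 <= i < n.+1) (if odd (n.+2 - i.-1) then G i else 1) =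
   \prod_(1 <= l < n.+1) (if odd (n - l.-1) then G l else 1).
  apply: eq_big_nat => i /andP[i1 i2]; have ni : (i.-1 <= n)%N by lia.
  by rewrite (subSn (leqW ni)) (subSn ni)/= negbK.
rewrite IH1 negbK; case: ifP => on; rewrite (big_nat_recr _ _ _ (ltn0Sn _))/=; congr (_ * G _);
  rewrite ?uphalf_half; have := odd_double_half n; lia.
Qed.

Lemma cc_prod n k : cc R a n k = \prod_(1 <= l < n.+1)
  ((Gamma (1 - omega n k l))%:C * (if odd (n - l.-1) then 1 - ee (omega n k l) else 1)).
Proof. by rewrite big_split/= prod_parity. Qed.

Lemma cc_pair n k : k \in Iprime a n ->
  ((2 * pi) ^- n)%:C * (cc R a n k * ee (2^-1 * \sum_(1 <= l < n.+1) (omega n k l - 2^-1))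
    * cc R a n (d a n - k)) = (psi a C n).[unitroot n k].
Proof.
move=> kI; have [n0|n1] := posnP n.
  rewrite n0 /cc/= !big_nil/= !mulr1 mulr0 ee0 expr0 invr1.
  by rewrite hornerC rmorph1 !mulr1.
have := @psi_alternating_prod a C C (horner_eval (unitroot n k)) n.
rewrite /= /horner_eval hornerX => <-; last first.
  move=> i ni; rewrite unitfE; have := @subr1_unitrootX_neq0 n k i.+1; apply=> //.
rewrite !cc_prod mulr_sumr ee_sum -!big_split/=.
have -> : ((2 * pi) ^- n)%:C = \prod_(1 <= l < n.+1) ((2 * pi)^-1)%:C :> C.
  by rewrite prodr_const_nat subSS subn0 -exprVn rmorphXn.
rewrite -big_split/= big_add1/= big_mkord; apply: eq_bigr => l _.
have ln : (1 <= l.+1 <= n)%N by rewrite ltn_ord.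
have w01 := omega_bounds ln kI; rewrite omega_compl// subKr.
have := ee_Gamma_factor w01; have := ee_omega k ln; rewrite rmorphM rmorphM /=.
set w := omega n k l.+1.
have -> : ee (1 - w) = ee (- w) by rewrite eeD (ee_nat R 1) mul1r.
move: (Gamma _)%:C (Gamma _)%:C (_^-1)%:C (ee (_ * _)) => g1 g2 p h.
(* For l congruent to n modulo 2 the two constants contribute (1 - e[w])(1 - e[-w]), and the Gamma
   factors cancel the second, leaving a numerator factor. Otherwise the Gamma factors alone give
   1/(1 - e[-w]), a denominator factor. *)
case: ifP => _ <- e.
  transitivity (p * (g2 * g1) * h * (1 - ee (- w)) * (1 - ee w)); first by ring.
  by rewrite e mul1r.
have nz : 1 - ee (- w) != 0.
  by apply: contra_eq_neq e => ->; rewrite mulr0 eq_sym oner_eq0.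
by apply: (mulIf nz); rewrite mulVf//; etransitivity; [|exact: e]; rewrite !mulr1; ring.
Qed.

Lemma ee_chtop n k p : (1 <= n)%N -> k \in Iprime a n ->
  ee ((-1) ^+ n.-1 * omega n k 1 * ((p.+1)%:Z%:~R - 1)) = unitroot n k ^+ p.
Proof.
case: n => // n _ kI; rewrite -pmulrn -natr1 addrK ee_natmul; congr (_ ^+ _).
rewrite omegaE /unitroot /=.
apply: (@ee_congr _ _ _ (- ((-1) ^+ n * Num.floor (omega_arg n.+1 k 1)))).
rewrite rmorphN rmorphM rmorphXn rmorphN1/= /omega_arg/= d0 expr0 !exprS.
by ring.
Qed.

Lemma chtop_pair n k p q : (1 <= n)%N -> k \in Iprime a n ->
  ((2 * pi) ^- n)%:C * (chtop R a n k p.+1%:Z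
    * ee (2^-1 * \sum_(1 <= l < n.+1) (omega n k l - 2^-1))
    * chtop R a n (d a n - k) q.+1%:Z) = (psi a C n).[unitroot n k] * unitroot n k ^+ p / unitroot n k ^+ q.
Proof.
move=> n1 kI; rewrite -cc_pair// /chtop !ee_chtop// ?Iprime_compl//.
have -> : unitroot n (d a n - k) = (unitroot n k)^-1.
  have kd : (k <= d a n)%N by move: kI; rewrite mem_Iprime => /and3P[].
  rewrite /unitroot -eeN natrB// mulrBr mulrBl mulfK ?dR_neq0//.
  apply: (@ee_congr _ _ _ ((-1) ^+ n.+1)).
  by rewrite opprK subrK rmorphXn rmorphN1.
rewrite exprVn; ring.
Qed.

End Omega.

(** * Discrete Fourier inversion *)

Section Form.
Variables (R : realType) (a : nat -> nat).
Hypothesis a_ge2 : forall i, (1 <= i)%N -> (2 <= a i)%N.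
Local Notation C := (R[i]).
Local Open Scope complex_scope.
Local Notation unitroot := (@unitroot R a).

(** Defined for all natural p and q, not just for column indices at level n, since the recursion in
    n keeps p and q while the matrix size drops. *)
Definition chform n p q : C :=
  ((chv R a n p.+1%:Z)^T *m eQ a (2^-1 : R) n *m etam R a n *m chv R a n q.+1%:Z) 0 0.

Definition spectral n p q k : C := (psi a C n).[unitroot n k] * unitroot n k ^+ p / unitroot n k ^+ q.

(** The average of phi_(n-1)(u) u^(p-q) over all d_n-th roots of unity u. *)
Definition fourier n p q : C := (d a n)%:R^-1 * \sum_(1 <= k < (d a n).+1) spectral n p q k.

Definition fourier_top n p q : C := (d a n)%:R^-1 * \sum_(k <- Iprime a n) spectral n p q k.

Lemma dC_neq0 n : (d a n)%:R != 0 :> C.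
Proof. by rewrite pnatr_eq0 -lt0n d_gt0. Qed.

Lemma sum_kap (T : nmodType) n (F : nat -> T) :
  \sum_(k < cnt a n) F (kap a n k) = \sum_(k <- Iprime a n) F k.
Proof. by rewrite [RHS](big_nth 0%N) big_mkord. Qed.

Lemma kap_in n (k : 'I_(cnt a n)) : kap a n k \in Iprime a n.
Proof. exact: mem_nth. Qed.

Lemma uniq_Iprime n : uniq (Iprime a n).
Proof. exact/filter_uniq/iota_uniq. Qed.

(** The top block of eta pairs each kappa with d_n - kappa alone, so every term is an instance of
    [chtop_pair]. *)
Lemma chform_fourier_top n p q : (1 <= n)%N ->
  ((2 * pi) ^- n)%:C *
  ((\col_(k < cnt a n) chtop R a n (kap a n k) p.+1%:Z)^T
   *m diag_mx (\row_(k < cnt a n) ee (2^-1 * \sum_(1 <= l < n.+1) (omega R a n (kap a n k) l - 2^-1)))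
   *m (\matrix_(k < cnt a n, l < cnt a n) ((d a n)%:R^-1 * (kap a n k + kap a n l == d a n)%:R))
   *m (\col_(k < cnt a n) chtop R a n (kap a n k) q.+1%:Z)) 0 0 = fourier_top n p q.
Proof.
move=> n1; rewrite mul_mx_diag -mulmxA !mxE mulr_sumr /fourier_top mulr_sumr -sum_kap.
apply: eq_bigr => k _; rewrite !mxE /spectral -chtop_pair// ?kap_in//.
have kI := kap_in k; have k'I := Iprime_compl n1 kI.
have kd : (kap a n k <= d a n)%N by move: kI; rewrite mem_Iprime => /and3P[].
have -> : \sum_j (\matrix_(k, l) ((d a n)%:R^-1 * (kap a n k + kap a n l == d a n)%:R) : 'M[C]_(cnt a n)) k j
    * (\col_(k < cnt a n) chtop R a n (kap a n k) q.+1%:Z) j 0 =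
    (d a n)%:R^-1 * chtop R a n (d a n - kap a n k) q.+1%:Z.
  under eq_bigr do rewrite !mxE.
  rewrite (sum_kap n (fun l => (d a n)%:R^-1 * (kap a n k + l == d a n)%:R * chtop R a n l q.+1%:Z)).
  rewrite (bigD1_seq _ k'I (uniq_Iprime n))/=.
  rewrite (_ : kap a n k + (d a n - kap a n k)%N = d a n)//; last exact: subnKC.
  rewrite eqxx mulr1.
  rewrite big1 ?addr0// => l lk; rewrite (_ : (_ == _)%N = false) ?mulr0 ?mul0r//.
  by apply: contraNF lk => /eqP <-; rewrite [(kap _ _ _ + l)%R]/(_ + _)%N addKn.
by ring.
Qed.

Lemma eQ_rec n : eQ a (2^-1 : R) n.+2 = block_mx
  (diag_mx (\row_(k < cnt a n.+2) ee (2^-1 * \sum_(1 <= l < n.+3) (omega R a n.+2 (kap a n.+2 k) l - 2^-1))))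
  0 0 (eQ a (2^-1 : R) n).
Proof.
rewrite /eQ -diag_mx_row; congr diag_mx; apply/rowP => i; rewrite !mxE.
by case: (fintype.split i) => j; rewrite !mxE.
Qed.

Lemma eQ1 : eQ a (2^-1 : R) 1 = diag_mx (\row_(k < cnt a 1)
  ee (2^-1 * \sum_(1 <= l < 2) (omega R a 1 (kap a 1 k) l - 2^-1))).
Proof. by rewrite /eQ; congr diag_mx; apply/rowP => k; rewrite !mxE big_nat1. Qed.

Lemma etam1 : etam R a 1 = \matrix_(k < cnt a 1, l < cnt a 1)
  ((d a 1)%:R^-1 * (kap a 1 k + kap a 1 l == d a 1)%:R).
Proof. by apply/matrixP => k l; rewrite !mxE dS d0 mul1n. Qed.

(** The factor 2 pi i on each side of the lower block squares to -(2 pi)^2. This absorbs two powers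
    of 1/(2 pi) and the minus sign in front of 1/a_(n+2). *)
Lemma chform_rec n p q :
  ((2 * pi) ^- n.+2)%:C * chform n.+2 p q =
  fourier_top n.+2 p q + (a n.+2)%:R^-1 * (((2 * pi) ^- n)%:C * chform n p q).
Proof.
rewrite -chform_fourier_top// {1}/chform eQ_rec /=.
rewrite tr_col_mx !mul_row_block !mulmx0 !addr0 !add0r mul_row_col [in LHS]mxE mulrDr.
congr (_ + _).
rewrite /chform -scalemxAr [(_ *: chv _ _ _ _)^T]linearZ/= !(=^~ scalemxAl, =^~ scalemxAr) !scalerA mxE.
have pi0 : (2 * pi) ^+ 2 != 0 :> R by rewrite expf_neq0// mulf_neq0// gt_eqF// pi_gt0.
have -> : ((2 * pi) ^- n.+2)%:C = ((2 * pi) ^- n)%:C * ((2 * pi) ^- 2)%:C :> C.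
  by rewrite -rmorphM -invfM -exprD addn2.
have t2 : ((2 * pi) ^- 2)%:C * (twopii R * twopii R) = -1.
  have -> : twopii R * twopii R = - ((2 * pi) ^+ 2)%:C.
    by rewrite /twopii; simpc; rewrite expr2.
  by rewrite mulrN -rmorphM/= mulVf.
move: t2; set p2 := (_ ^- 2)%:C; set t := twopii R => t2.
set r := ((2 * pi) ^- n)%:C; set b := (a n.+2)%:R^-1; set g := (_ 0 0).
have -> : r * p2 * (t * t * - b * g) = - (p2 * (t * t)) * (r * b * g) by ring.
by rewrite t2 opprK mul1r; ring.
Qed.

Lemma big_Iprime (T : nmodType) n (F : nat -> T) :
  \sum_(1 <= k < (d a n).+1) F k =
  \sum_(k <- Iprime a n) F k + \sum_(1 <= k < (d a n).+1 | (a n %| k)%N) F k.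
Proof.
rewrite (bigID (fun k => a n %| k)%N)/= addrC; congr (_ + _).
by rewrite /Iprime big_filter /index_iota subn1.
Qed.

Lemma unitroot_muln n k m : (1 <= m)%N -> (k * m = d a n)%N -> forall c, unitroot n (k * c)%N =
  ee ((-1) ^+ n.+1 * c%:R / m%:R).
Proof.
move=> m1 km c; rewrite /unitroot -km !natrM; congr ee; field.
have := dR_neq0 R a_ge2 n; rewrite -km natrM mulf_eq0 negb_or => /andP[-> ->] //.
Qed.

Lemma geometric_eq0 (z : C) N : z != 1 -> z ^+ N = 1 -> \sum_(i < N) z ^+ i = 0.
Proof.
move=> z1 zN; have := subrX1 z N; rewrite zN subrr => /esym/eqP.
by rewrite mulf_eq0 subr_eq0 (negPf z1) => /eqP.
Qed.

Lemma ee_sign_frac_neq1 n k N : (0 < N)%N -> ~~ (N %| k)%N ->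
  ee ((-1) ^+ n * k%:R / N%:R : R) != 1.
Proof.
move=> N0 Nk; apply: contraNneq Nk => /ee_eq1[z zE].
have N0R : N%:R != 0 :> R by rewrite pnatr_eq0 -lt0n.
apply/dvdnP; exists `|z|%N; apply/eqP; rewrite -(eqr_nat R) natrM natr_absz intr_norm -zE.
by rewrite !normrM normfV !normr_nat normr_sign mul1r divfK.
Qed.

(** For k = a_(n+2) k', u is a d_(n+1)-th root of unity, so u^(d_n) is an a_(n+1)-th one. The last
    factor of [psi] sums its powers: it gives a_(n+1) when a_(n+1) divides k', and 0 otherwise. *)
Lemma spectral_rec n p q :
  \sum_(1 <= k < (d a n.+2).+1 | (a n.+2 %| k)%N) spectral n.+2 p q k =
  (a n.+1)%:R * \sum_(1 <= k < (d a n).+1) spectral n p q k.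
Proof.
have a1 : (0 < a n.+1)%N by rewrite ltnW ?a_ge2.
have a2 : (0 < a n.+2)%N by rewrite ltnW ?a_ge2.
rewrite dS big_multiples// dS (bigID (fun k => a n.+1 %| k)%N)/= big_multiples//.
have psiE k : (psi a C n.+2).[unitroot n.+2 k] =
    (psi a C n).[unitroot n.+2 k] * \sum_(i < a n.+1) (unitroot n.+2 k ^+ d a n) ^+ i.
  rewrite psiSS hornerM horner_sum; congr (_ * _).
  by apply: eq_bigr => i _; rewrite -exprM hornerXn exprM.
have rootW k : unitroot n.+2 (a n.+2 * k)%N = ee ((-1) ^+ n.+1 * k%:R / (d a n.+1)%:R).
  rewrite (@unitroot_muln _ _ (d a n.+1)) ?d_gt0//; last by rewrite [RHS]dS mulnC.
  by rewrite !exprS !mulN1r opprK.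
rewrite [X in _ + X]big1 ?addr0 => [|k ak].
  rewrite mulr_sumr; apply: eq_bigr => k _.
  have rootE : unitroot n.+2 (a n.+2 * (a n.+1 * k))%N = unitroot n k.
    rewrite rootW /unitroot dS !natrM; congr ee; field.
    by rewrite (dR_neq0 R a_ge2) pnatr_eq0 -lt0n a1.
  rewrite /spectral psiE rootE.
  rewrite unitroot_unity//; under eq_bigr do rewrite expr1n.
  by rewrite sumr_const card_ord; ring.
rewrite /spectral psiE geometric_eq0 ?mulr0 ?mul0r//; last first.
  rewrite -exprM -dS rootW -ee_natmul divfK ?(dR_neq0 R a_ge2)//.
  apply: (@etrans _ _ (ee (((-1) ^+ n.+1 * k%:Z)%:~R : R))); last exact: ee_int.
  by rewrite intrM rmorphXn rmorphN1.
rewrite rootW -ee_natmul.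
have -> : (-1) ^+ n.+1 * k%:R / (d a n.+1)%:R * (d a n)%:R = (-1) ^+ n.+1 * k%:R / (a n.+1)%:R :> R.
  by rewrite dS natrM; field; rewrite (dR_neq0 R a_ge2) pnatr_eq0 -lt0n a1.
exact: ee_sign_frac_neq1.
Qed.

(** The a_(n+1) from [spectral_rec] cancels in d_(n+2) = d_n a_(n+1) a_(n+2), which leaves the same
    coefficient as in [chform_rec]. *)
Lemma fourier_rec n p q : fourier n.+2 p q = fourier_top n.+2 p q + (a n.+2)%:R^-1 * fourier n p q.
Proof.
rewrite /fourier big_Iprime mulrDr; congr (_ + _).
rewrite spectral_rec 2!dS !natrM; field.
rewrite dC_neq0 !pnatr_eq0 -!lt0n.
by have := a_ge2 (ltn0Sn n); have := a_ge2 (ltn0Sn n.+1); case: (a n.+1) (a n.+2) => [|?] [|?].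
Qed.

Lemma unitroot_full n : unitroot n (d a n) = 1.
Proof.
rewrite /unitroot mulfK ?(dR_neq0 R a_ge2)//.
by rewrite (_ : (-1) ^+ n.+1 = ((-1) ^+ n.+1 : int)%:~R) ?ee_int// rmorphXn rmorphN1.
Qed.

(** The only index missing from I'_1 is a_1, where u = 1 is a zero of phi_0 = 1 - t. *)
Lemma fourier1 p q : fourier 1 p q = fourier_top 1 p q.
Proof.
rewrite /fourier big_Iprime -[RHS]addr0 mulrDr; congr (_ + _).
have a1 : (0 < a 1)%N by rewrite ltnW ?a_ge2.
have -> : \sum_(1 <= k < (d a 1).+1 | (a 1 %| k)%N) spectral 1 p q k = spectral 1 p q (d a 1).
  have d1 : d a 1 = (1 * a 1)%N by rewrite dS d0.
  have := big_multiples 1 (spectral 1 p q) a1; rewrite -d1 => ->.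
  by rewrite big_nat1 d1 mulnC.
by rewrite /spectral unitroot_full hornerD hornerN hornerX hornerC subrr !mul0r mulr0.
Qed.

Lemma chform_fourier n p q : ((2 * pi) ^- n)%:C * chform n p q = fourier n p q.
Proof.
suff [] : ((2 * pi) ^- n)%:C * chform n p q = fourier n p q /\
   ((2 * pi) ^- n.+1)%:C * chform n.+1 p q = fourier n.+1 p q by [].
elim: n => [|n [IH1 IH2]]; split; last 1 first.
- by rewrite chform_rec IH1 fourier_rec.
- have -> : fourier 0 p q = 1.
    have root01 : unitroot 0 1 = 1 by have := unitroot_full 0; rewrite d0.
    rewrite /fourier d0 big_nat1 /spectral root01.
    by rewrite hornerC !expr1n !mulr1 !invr1 !mulr1.
  rewrite expr0 invr1 mul1r /chform/= mulmx1 !mxE big_ord1 !mxE mulr1.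
  by rewrite big_ord1 !mxE eqxx mulr1n mulr0 ee0 mulr1.
- rewrite fourier1 -(chform_fourier_top _ _ (ltnSn 0)); congr (_ * _).
  by rewrite /chform eQ1 etam1.
- exact: IH2.
Qed.

Lemma fourierE n p q : (p < mu a n)%N -> (q < mu a n)%N ->
  fourier n p q = if (p <= q)%N then (psi a C n)`_(q - p) else 0.
Proof.
move=> pn qn.
have D0 := d_gt0 a_ge2 n; have muD := leq_mu_d a_ge2 n; have sz := size_psi a_ge2 C n.
pose w m : C := ee ((-1) ^+ n.+1 * (m%:R - q%:R) / (d a n)%:R).
have spE k : spectral n p q k = \sum_(m < size (psi a C n)) (psi a C n)`_m * w (m + p)%N ^+ k.
  rewrite /spectral horner_coef -mulrA mulr_suml; apply: eq_bigr => m _.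
  rewrite -mulrA; congr (_ * _); rewrite mulrA -exprD /unitroot /w -!ee_natmul -eeN -eeD.
  by congr ee; field; exact: dR_neq0.
(* Orthogonality of characters. As m and q are both below d_n, [w m] is 1 only for m = q. *)
have sumw m : (m < d a n)%N -> \sum_(1 <= k < (d a n).+1) w m ^+ k = (m == q)%:R * (d a n)%:R.
  move=> mD; have [->|mq] := eqVneq m q.
    rewrite mul1r -[(d a n)%:R]/(1 *+ d a n) -[X in _ *+ X](subn1 (d a n).+1) -sumr_const_nat.
    by apply: eq_bigr => k _; rewrite /w subrr mulr0 mul0r ee0 expr1n.
  have wN : w m ^+ d a n = 1.
    rewrite /w -ee_natmul divfK ?(dR_neq0 R a_ge2)//.
    apply: (@etrans _ _ (ee (((-1) ^+ n.+1 * (m%:Z - q%:Z))%:~R : R))); last exact: ee_int.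
    by rewrite intrM rmorphXn rmorphN1 rmorphB.
  rewrite mul0r big_add1 big_mkord; under eq_bigr do rewrite exprS.
  rewrite -mulr_sumr geometric_eq0 ?mulr0// /w.
  have /orP[mq'|mq'] : (m < q)%N || (q < m)%N by rewrite -neq_ltn.
    rewrite (_ : (-1) ^+ n.+1 * (m%:R - q%:R) = (-1) ^+ n.+2 * (q - m)%N%:R).
      by apply: ee_sign_frac_neq1 => //; rewrite gtnNdvd ?subn_gt0//; lia.
    by rewrite natrB ?(ltnW mq')// !exprS; ring.
  rewrite -natrB ?(ltnW mq')//.
  by apply: ee_sign_frac_neq1 => //; rewrite gtnNdvd ?subn_gt0//; lia.
rewrite /fourier; under eq_bigr do rewrite spE.
rewrite exchange_big/=; under eq_bigr do rewrite -mulr_sumr.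
(* No aliasing occurs: m <= d_n - mu_n by [size_psi] and p < mu_n, so m + p < d_n. *)
have -> : \sum_(m < size (psi a C n)) (psi a C n)`_m * (\sum_(1 <= k < (d a n).+1) w (m + p)%N ^+ k) =
   \sum_(m < size (psi a C n)) (psi a C n)`_m * ((m + p == q)%N%:R * (d a n)%:R).
  by apply: eq_bigr => m _; rewrite sumw//; have := ltn_ord m; lia.
under eq_bigr do rewrite mulrA; rewrite -mulr_suml mulrC mulfK ?dC_neq0//.
case: leqP => pq; last first.
  by rewrite big1// => m _; rewrite (_ : (_ == _)%N = false) ?mulr0//; lia.
have [sp|sp] := leqP (size (psi a C n)) (q - p).
  rewrite nth_default// big1// => m _.
  by rewrite (_ : (_ == _)%N = false) ?mulr0//; have := ltn_ord m; lia.
rewrite (bigD1 (Ordinal sp))//= subnK// eqxx mulr1 big1 ?addr0// => m /eqP mE.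
rewrite (_ : (_ == _)%N = false) ?mulr0//; apply/eqP => mp; apply: mE.
by apply/val_inj => /=; lia.
Qed.

(** * Symmetries of eta and Q, and the two matrix identities *)

Lemma etam_sym n : (etam R a n)^T = etam R a n.
Proof.
suff [] : (etam R a n)^T = etam R a n /\ (etam R a n.+1)^T = etam R a n.+1 by [].
have top_sym m : (\matrix_(k < cnt a m, l < cnt a m)
    ((d a m)%:R^-1 * (kap a m k + kap a m l == d a m)%:R) : 'M[C]__)^T =
    \matrix_(k < cnt a m, l < cnt a m) ((d a m)%:R^-1 * (kap a m k + kap a m l == d a m)%:R).
  by apply/matrixP => k l; rewrite !mxE addrC.
elim: n => [|n [IH1 IH2]]; split=> //.
- by rewrite /= trmx1.
- by rewrite etam1 top_sym.
- by rewrite /= tr_block_mx !trmx0 top_sym linearZ/= IH1.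
Qed.

Lemma sum_omega_compl n k : k \in Iprime a n ->
  \sum_(1 <= l < n.+1) (omega R a n (d a n - k) l - 2^-1) =
  - \sum_(1 <= l < n.+1) (omega R a n k l - 2^-1).
Proof.
move=> kI; rewrite -sumrN; apply: eq_big_nat => l; rewrite ltnS => ln.
by rewrite omega_compl//; field.
Qed.

(** Q changes sign under kappa -> d_n - kappa, the pairing made by eta, so the two exponentials
    cancel at each nonzero entry. *)
Lemma eQ_etam_eQ n :
  eQ a (2^-1 : R) n *m etam R a n *m eQ a (2^-1 : R) n = etam R a n.
Proof.
suff [] : eQ a (2^-1 : R) n *m etam R a n *m eQ a (2^-1 : R) n = etam R a n /\
  eQ a (2^-1 : R) n.+1 *m etam R a n.+1 *m eQ a (2^-1 : R) n.+1 = etam R a n.+1 by [].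
have top_inv m : let E := diag_mx (\row_(k < cnt a m)
      ee (2^-1 * \sum_(1 <= l < m.+1) (omega R a m (kap a m k) l - 2^-1))) in
    let M := \matrix_(k < cnt a m, l < cnt a m)
      ((d a m)%:R^-1 * (kap a m k + kap a m l == d a m)%:R) in
    E *m M *m E = M.
  move=> E M; rewrite /E mul_diag_mx mul_mx_diag; apply/matrixP => k l; rewrite !mxE.
  case: eqP => [kl|_]; last by rewrite !(mulr0, mul0r).
  have -> : kap a m l = (d a m - kap a m k)%N by rewrite -kl [(kap _ _ _ + _)%R]/(_ + _)%N addKn.
  by rewrite sum_omega_compl ?kap_in// mulrN mulrAC ee_mulVr mul1r.
elim: n => [|n [IH1 IH2]]; split=> //.
- rewrite /= mulmx1 (_ : eQ _ _ _ = 1%:M) ?mulmx1//.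
  apply/matrixP => i j; rewrite !mxE mulr0 ee0//.
- by rewrite eQ1 etam1 top_inv.
- rewrite eQ_rec /= !mulmx_block !(mulmx0, mul0mx, addr0, add0r) top_inv.
  by rewrite -scalemxAr -scalemxAl IH1.
Qed.

Lemma eQ_sqr n : eQ a (1 : R) n = eQ a (2^-1 : R) n *m eQ a (2^-1 : R) n.
Proof.
rewrite /eQ mulmx_diag; congr diag_mx; apply/rowP => i; rewrite !mxE -eeD.
by congr ee; field.
Qed.

Lemma chnorm_form n :
  (chnorm R a n)^T *m eQ a (2^-1 : R) n *m etam R a n *m chnorm R a n = chim R a n.
Proof.
rewrite /chnorm -scalemxAr [(_ *: chm _ _ _)^T]linearZ/= !(=^~ scalemxAl, =^~ scalemxAr) scalerA.
set s := (_^-1)%:C.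
have -> : s * s = ((2 * pi) ^- n)%:C.
  have p0 : 0 <= 2 * pi :> R by rewrite mulr_ge0// pi_ge0.
  rewrite -rmorphM -invfM -powRD.
    by rewrite -splitr powR_mulrn.
  by apply/implyP => _; rewrite mulf_neq0// gt_eqF// pi_gt0.
apply/matrixP => p q; rewrite mxE chimE// -fourierE// -chform_fourier.
congr (_ * _); rewrite /chform; set M := etam R a n; set E := eQ _ _ _.
rewrite -!mulmxA !mxE; apply: eq_bigr => k _; rewrite !mxE; congr (_ * _).
apply: eq_bigr => l _; rewrite !mxE; congr (_ * _).
by apply: eq_bigr => m _; rewrite !mxE.
Qed.

End Form.

(** With X = V^T E eta V, symmetry gives X^T = V^T eta E V, while X V^-1 E^2 V = V^T (E eta E) E V =
    V^T eta E V. *)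
Lemma conj_sqr_form (F : comUnitRingType) m (V E eta : 'M[F]_m) :
  E^T = E -> eta^T = eta -> E *m eta *m E = eta ->
  V \in unitmx -> V^T *m E *m eta *m V \in unitmx ->
  invmx V *m (E *m E) *m V =
  invmx (V^T *m E *m eta *m V) *m (V^T *m E *m eta *m V)^T.
Proof.
move=> Esym etasym EetaE VU XU; apply: (can_inj (mulKmx XU)); rewrite mulKVmx//.
rewrite !trmx_mul trmxK Esym etasym -[LHS]mulmxA -[invmx V *m _ *m V]mulmxA mulKVmx//.
by rewrite -!mulmxA; congr (_ *m _); rewrite !mulmxA EetaE.
Qed.

Theorem theorem3p4 (R : realType) (a : nat -> nat)
  (ha : forall i : nat, (1 <= i)%N -> (2 <= a i)%N) (n : nat) :
  @chnorm R a n \in unitmx /\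
  invmx (@chnorm R a n) *m @eQ R a 1 n *m @chnorm R a n = @Serre R a n /\
  (@chnorm R a n)^T *m @eQ R a (2^-1) n *m @etam R a n *m @chnorm R a n = @chim R a n.
Proof.
have form := @chnorm_form R a ha n; have chiU := @chim_unit a ha R n.
(* Invertibility of ch_Gamma is read off the second identity: it is a factor of the invertible
   [chim]. *)
have VU : chnorm R a n \in unitmx by move: chiU; rewrite -form unitmx_mul => /andP[].
split=> //; split=> //.
rewrite /Serre -form eQ_sqr; apply: conj_sqr_form; rewrite ?form ?chiU//.
- exact: tr_diag_mx.
- exact: etam_sym.
- exact: eQ_etam_eQ.
Qed.
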